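(* Let $(A_\mu,B_\nu,\vartriangleright,\vartriangleleft,\rightharpoonup,\leftharpoonup,\theta)$ be a quasi-twilled associative algebra over a field of characteristic $0$ and let $D:A\to B$ be a fixed strong deformation map in it. Let $\mathfrak a=\bigoplus_{n\ge0}\mathfrak a_n$, $\mathfrak a_n=\mathrm{Hom}(A^{\otimes n+1},B)$, and for $f,g\in\mathfrak a$ put $l_1(f)=[\mu_{\vartriangleright,\vartriangleleft},f]$ and $l_2(f,g)=[[\nu_{\rightharpoonup,\leftharpoonup},f],g]$. Then $(\mathfrak a,\{l_k^D\}_{k=1}^\infty)$ is an $L_\infty$-algebra, where for $f,g\in\mathfrak a$, $$l_1^D(f)=l_1(f)+l_2(D,f),\qquad l_2^D(f,g)=l_2(f,g),\qquad l_k^D=0\ \text{ for }k\ge3.$$ Moreover, for any linear map $D':A\to B$, the sum $D+D'$ is also a strong deformation map if and only if $D'\in\mathfrak a_0$ is a Maurer-Cartan element of the $L_\infty$-algebra $(\mathfrak a,\{l_k^D\}_{k=1}^\infty)$.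
   Context: A quasi-twilled associative algebra is an associative algebra with a fixed vector space decomposition $\mathbb A=A\oplus B$ such that $B$ is a subalgebra. Its multiplication has the form $(a,x)\cdot_{\mathbb A}(b,y)=(a\cdot_A b+a\leftharpoonup y+x\rightharpoonup b,\ x\cdot_B y+a\vartriangleright y+x\vartriangleleft b+\theta(a,b))$ for unique bilinear maps $\mu=\cdot_A:A\times A\to A$, $\nu=\cdot_B:B\times B\to B$, $\vartriangleright:A\times B\to B$, $\vartriangleleft:B\times A\to B$, $\rightharpoonup:B\times A\to A$, $\leftharpoonup:A\times B\to A$, $\theta:A\times A\to B$; one writes it as the tuple $(A_\mu,B_\nu,\vartriangleright,\vartriangleleft,\rightharpoonup,\leftharpoonup,\theta)$. Put $\mu_{\vartriangleright,\vartriangleleft}((a,x),(b,y))=(a\cdot_A b,\ a\vartriangleright y+x\vartriangleleft b)$ and $\nu_{\rightharpoonup,\leftharpoonup}((a,x),(b,y))=(a\leftharpoonup y+x\rightharpoonup b,\ x\cdot_B y)$. A strong deformation map is a linear map $D:A\to B$ with $D(a\cdot_A b+a\leftharpoonup D(b)+D(a)\rightharpoonup b)=D(a)\cdot_B D(b)+a\vartriangleright D(b)+D(a)\vartriangleleft b+\theta(a,b)$ for all $a,b\in A$. Brackets are taken in the graded Lie algebra $\mathfrak g=\bigoplus_{n\ge0}\mathfrak g_n$, $\mathfrak g_n=\mathrm{Hom}((A\oplus B)^{\otimes n+1},A\oplus B)$, with the Gerstenhaber bracket: for $f$ with $m$ inputs and $g$ with $n$ inputs, $[f,g]=f\diamond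 g-(-1)^{(m-1)(n-1)}g\diamond f$, where $(f\diamond g)(v_1,\ldots,v_{m+n-1})=\sum_{i=1}^m(-1)^{(i-1)(n-1)}f(v_1,\ldots,v_{i-1},g(v_i,\ldots,v_{i+n-1}),v_{i+n},\ldots,v_{m+n-1})$. Maps $A^{\otimes n+1}\to B$ are regarded as elements of $\mathfrak g_n$ by extending them by zero. An $L_\infty$-algebra is a graded vector space $\mathcal G$ with graded symmetric (with Koszul sign $\epsilon(\sigma)$) degree $1$ maps $l_k:\mathcal G^{\otimes k}\to\mathcal G$, $k\ge1$, such that for all $N\ge1$ and homogeneous $x_1,\ldots,x_N$: $\sum_{i=1}^N\sum_{\sigma\in Sh(i,N-i)}\epsilon(\sigma)\,l_{N-i+1}(l_i(x_{\sigma(1)},\ldots,x_{\sigma(i)}),x_{\sigma(i+1)},\ldots,x_{\sigma(N)})=0$, where $Sh(i,N-i)$ is the set of $(i,N-i)$-shuffles. A Maurer-Cartan element is $\alpha\in\mathcal G_0$ with $\sum_{k\ge1}\frac1{k!}l_k(\alpha,\ldots,\alpha)=0$. *)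

(* Defs.v *)
From HB Require Import structures.
From mathcomp Require Import all_boot all_order all_algebra all_fingroup.
From mathcomp Require Import boolp classical_sets functions.

Set Implicit Arguments.
Unset Strict Implicit.
Unset Printing Implicit Defensive.

Import GRing.Theory.
Local Open Scope ring_scope.

(* A family of maps F_k : U^k -> W, one for each number k of arguments, is      *)
(* encoded as a single function F : seq U -> W, F_k being the restriction of F  *)
(* to lists of length k.                                                        *)
Definition multilinear (K : fieldType) (U W : lmodType K) (F : seq U -> W) : Prop :=
  forall (s1 s2 : seq U) (c : K) (u v : U),
    F (s1 ++ (c *: u + v) :: s2) = c *: F (s1 ++ u :: s2) + F (s1 ++ v :: s2).

Section Cochains.
Variables (K : fieldType) (U W : lmodType K).

(* [cochain U W] is the direct sum over n >= 0 of Hom(U^{(x) n+1}, W): there is *)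
(* no component without arguments, and only finitely many components are        *)
(* nonzero.                                                                     *)
Definition cochain_pred : {pred (seq U -> W)} := fun F =>
  `[< [/\ multilinear F, F [::] = 0 &
          exists N : nat, forall s, (N < size s)%N -> F s = 0] >].

Lemma cochain_submod_closed : submod_closed cochain_pred.
Proof.
split.
  apply/asboolP; split; [|by []|by exists 0%N].
  by move=> s1 s2 c u v; rewrite -[LHS]/(0 : W) -![(0 : seq U -> W) _]/(0 : W) scaler0 addr0.
move=> c F G /asboolP[Fm F0 [N FN]] /asboolP[Gm G0 [M GM]].
apply/asboolP; split.
- move=> s1 s2 d u v; rewrite !fctE Fm Gm.
  by rewrite !scalerDr !scalerA (mulrC c d) addrACA.
- by rewrite !fctE F0 G0 scaler0 addr0.
- exists (maxn N M) => s; rewrite gtn_max => /andP[hN hM].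
  by rewrite !fctE FN // GM // scaler0 addr0.
Qed.

HB.instance Definition _ := GRing.isSubmodClosed.Build K (seq U -> W) cochain_pred
  cochain_submod_closed.

Record cochain := Cochain { cfun :> seq U -> W; cfunP : cfun \in cochain_pred }.

HB.instance Definition _ := [isSub for cfun].
HB.instance Definition _ := [Choice of cochain by <:].
HB.instance Definition _ := [SubChoice_isSubLmodule of cochain by <:].

(* Elements with n + 1 arguments have degree n; for n < 0 only 0 has degree n. *)
Definition cochain_deg (n : int) (F : cochain) : Prop :=
  forall s, F s != 0 -> (size s)%:Z = n + 1.

Lemma cochain_multilinear (F : cochain) : multilinear F.
Proof. by case/asboolP: (cfunP F). Qed.

Lemma cochain_nil (F : cochain) : F [::] = 0.
Proof. by case/asboolP: (cfunP F). Qed.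

Lemma cochain_bounded (F : cochain) :
  exists N : nat, forall s, (N < size s)%N -> F s = 0.
Proof. by case/asboolP: (cfunP F). Qed.

Lemma cochain0 (F : cochain) s1 s2 : F (s1 ++ 0 :: s2) = 0.
Proof.
have := cochain_multilinear F s1 s2 1 0 0; rewrite !scale1r addr0 => /eqP.
by rewrite -subr_eq0 opprD addrA subrr sub0r oppr_eq0 => /eqP.
Qed.

End Cochains.

Section LinearBilinear.
Variables (K : fieldType) (U W : lmodType K).

Definition lin_fun (D : U -> W) (s : seq U) : W :=
  if s is [:: u] then D u else 0.

Lemma lin_funP (D : {linear U -> W}) : lin_fun D \in @cochain_pred K U W.
Proof.
apply/asboolP; split=> //; last by exists 1%N => -[|? [|? ?]].
move=> [|a [|b s1]] [|d s2] c u v //=; rewrite ?scaler0 ?addr0 //.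
exact: linearP.
Qed.

Definition lin_cochain (D : {linear U -> W}) : cochain U W := Cochain (lin_funP D).

Definition bilin_fun (m : U -> U -> W) (s : seq U) : W :=
  if s is [:: u; v] then m u v else 0.

Lemma bilin_funP (m : {bilinear U -> U -> W}) :
  bilin_fun m \in @cochain_pred K U W.
Proof.
apply/asboolP; split=> //; last by exists 2%N => -[|? [|? [|? ?]]].
move=> [|a [|b [|b' s1]]] [|d [|d' s2]] c u v //=; rewrite ?scaler0 ?addr0 //.
  by rewrite linearPl.
by rewrite linearPr.
Qed.

Definition bilin_cochain (m : {bilinear U -> U -> W}) : cochain U W :=
  Cochain (bilin_funP m).

End LinearBilinear.

Section Gerstenhaber.
Variables (K : fieldType) (V : lmodType K).

(* Insertion of the component of g with q + 1 arguments at position i, where    *)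
(* positions are numbered from 0.                                               *)
Definition insert_at (i q : nat) (f g : seq V -> V) (s : seq V) : V :=
  f (take i s ++ g (take q.+1 (drop i s)) :: drop (i + q.+1) s).

(* f <> g for f with p + 1 and g with q + 1 arguments; s has length p + q + 1.   *)
Definition circ (p q : nat) (f g : seq V -> V) (s : seq V) : V :=
  \sum_(i < p.+1) (-1) ^+ (i * q) *: insert_at i q f g s.

Definition gbracket_hom (p q : nat) (f g : seq V -> V) (s : seq V) : V :=
  circ p q f g s - (-1) ^+ (p * q) *: circ q p g f s.

(* The bilinear extension to the direct sum: the pairs of components of degrees *)
(* p and q contribute to the component with p + q + 1 arguments.                *)
Definition gbracket_fun (f g : seq V -> V) (s : seq V) : V :=
  \sum_(p < size s) \sum_(q < size s | (p + q).+1 == size s) gbracket_hom p q f g s.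

Definition multilinear_at (s1 s2 : seq V) (F : seq V -> V) : Prop :=
  forall (c : K) (u v : V),
    F (s1 ++ (c *: u + v) :: s2) = c *: F (s1 ++ u :: s2) + F (s1 ++ v :: s2).

Lemma insert_at_multilinear (f g : cochain V V) i q s1 s2 :
  multilinear_at s1 s2 (insert_at i q f g).
Proof.
move=> c u v; rewrite /insert_at !take_cat !drop_cat.
case: ltnP => hi.
  have e : forall w, take q.+1 (drop i s1 ++ w :: s2) =
     if (q.+1 <= size s1 - i)%N then take q.+1 (drop i s1)
     else drop i s1 ++ w :: take (q - (size s1 - i)) s2.
    move=> w; have [hq|hq] := leqP q.+1 (size s1 - i).
      by rewrite takel_cat // size_drop.
    by rewrite take_cat size_drop ltnNge ltnW //= subSn.
  rewrite !e; have [hq|hq] := leqP q.+1 (size s1 - i).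
    have h1 : (i + q.+1 <= size s1)%N by rewrite -leq_subRL // ltnW.
    case: ltngtP h1 => // [h1|h1] _.
      by rewrite -!cat_cons !catA cochain_multilinear.
    rewrite h1 subnn !drop0.
    by rewrite -![g _ :: _ :: s2](cat_cons _ [::]) !catA cochain_multilinear.
  have h1 : (size s1 < i + q.+1)%N by rewrite -ltn_subLR // ltnW.
  rewrite ltnNge (ltnW h1) /=.
  case E : (i + q.+1 - size s1)%N => [|k].
    by move/eqP: E; rewrite subn_eq0 leqNgt h1.
  by rewrite /= !cochain_multilinear.
have -> : (i + q.+1 < size s1)%N = false by rewrite ltnNge (leq_trans hi) ?leq_addr.
rewrite -addnBAC //; case: (i - size s1)%N => [|k] /=.
  by rewrite cats0 (cochain_multilinear g [::]) cochain_multilinear.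
by rewrite -!catA /= cochain_multilinear.
Qed.

Lemma circ_multilinear (f g : cochain V V) p q s1 s2 :
  multilinear_at s1 s2 (circ p q f g).
Proof.
move=> c u v; rewrite /circ scaler_sumr -big_split /=; apply: eq_bigr => i _.
by rewrite insert_at_multilinear ?scalerDr ?scalerA 1?mulrC.
Qed.

Lemma insert_at_bounded (f g : cochain V V) i p q s N M :
  (forall s, (N < size s)%N -> f s = 0) -> (forall s, (M < size s)%N -> g s = 0) ->
  (i <= p)%N -> (p + q).+1 = size s -> (N + M < size s)%N ->
  insert_at i q f g s = 0.
Proof.
move=> fN gM hi hs hNM; rewrite /insert_at.
have hiq : (i + q.+1 <= size s)%N by rewrite -hs addnS ltnS leq_add2r.
have [hM|hM] := ltnP M q.+1.
  rewrite gM ?cochain0 // size_takel // size_drop leq_subRL ?(leq_trans _ hiq) //.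
  exact: leq_addr.
rewrite fN // size_cat /= size_drop size_takel ?(leq_trans (leq_addr _ _) hiq) //.
have -> : (size s - (i + q.+1) = p - i)%N.
  by rewrite -hs -addnS subnDr.
rewrite addnS subnKC // ltnS -(leq_add2r q) -ltnS hs.
by rewrite (leq_ltn_trans _ hNM) // leq_add2l ltnW.
Qed.

Lemma circ_bounded (f g : cochain V V) p q s N M :
  (forall s, (N < size s)%N -> f s = 0) -> (forall s, (M < size s)%N -> g s = 0) ->
  (p + q).+1 = size s -> (N + M < size s)%N -> circ p q f g s = 0.
Proof.
move=> fN gM hs hNM; apply: big1 => i _.
by rewrite (insert_at_bounded fN gM _ hs hNM) ?scaler0 // -ltnS.
Qed.

Lemma gbracketP (f g : cochain V V) : gbracket_fun f g \in @cochain_pred K V V.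
Proof.
apply/asboolP; split.
- move=> s1 s2 c u v; rewrite /gbracket_fun !size_cat /=.
  rewrite scaler_sumr -big_split /=; apply: eq_bigr => p _.
  rewrite scaler_sumr -big_split /=; apply: eq_bigr => q /eqP hpq.
  rewrite /gbracket_hom !circ_multilinear.
  by rewrite scalerDr scalerBr !scalerA [c * _]mulrC opprD addrACA.
- by rewrite /gbracket_fun big_ord0.
- have [N fN] := cochain_bounded f; have [M gM] := cochain_bounded g.
  exists (N + M)%N => s hs; apply: big1 => p _; apply: big1 => q /eqP hpq.
  rewrite /gbracket_hom (circ_bounded fN gM) // (circ_bounded gM fN) //.
  + by rewrite scaler0 subr0.
  + by rewrite addnC.
  + by rewrite addnC.
Qed.

Definition gbracket (f g : cochain V V) : cochain V V := Cochain (gbracketP f g).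

End Gerstenhaber.

Section Linfty.
Variables (K : fieldType) (E : lmodType K).

(* E is the internal direct sum of the subspaces gr n. *)
Record is_grading (gr : int -> E -> Prop) : Prop := IsGrading {
  gr_zero : forall n, gr n 0;
  gr_linear : forall n (c : K) u v, gr n u -> gr n v -> gr n (c *: u + v);
  gr_span : forall x, exists (s : seq int) (y : int -> E),
    (forall n, gr n (y n)) /\ x = \sum_(n <- s) y n;
  gr_indep : forall (s : seq int) (y : int -> E), uniq s ->
    (forall n, gr n (y n)) -> \sum_(n <- s) y n = 0 ->
    forall n, n \in s -> y n = 0 }.

(* x_0 ... x_{N-1} = koszul d s * x_{s 0} ... x_{s (N-1)} in the free graded     *)
(* commutative algebra, where x_i has degree d i.                                *)
Definition koszul (N : nat) (d : 'I_N -> int) (s : 'S_N) : K :=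
  \prod_(i < N) \prod_(j < N | (i < j)%N && (s j < s i)%N) (-1) ^ (d (s i) * d (s j)).

Definition shuffle (N i : nat) (s : 'S_N) : bool :=
  [forall j : 'I_N, forall k : 'I_N,
    [&& (j < k)%N & (k < i)%N || (i <= j)%N] ==> (s j < s k)%N].

Definition perm_seq (N : nat) (x : 'I_N -> E) (s : 'S_N) : seq E :=
  [seq x (s j) | j <- enum 'I_N].

(* The operations l_k, k >= 1, are the restrictions of l to lists of length k; *)
(* the value of l on the empty list is irrelevant.                              *)
Record linfty_algebra (gr : int -> E -> Prop) (l : seq E -> E) : Prop :=
  LinftyAlgebra {
  linfty_grading : is_grading gr;
  linfty_multilinear : multilinear l;
  linfty_symmetric : forall (N : nat) (d : 'I_N -> int) (x : 'I_N -> E) (s : 'S_N),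
    (0 < N)%N -> (forall i, gr (d i) (x i)) ->
    l (perm_seq x 1%g) = koszul d s *: l (perm_seq x s);
  linfty_degree : forall (N : nat) (d : 'I_N -> int) (x : 'I_N -> E),
    (0 < N)%N -> (forall i, gr (d i) (x i)) ->
    gr (1 + \sum_i d i) (l (perm_seq x 1%g));
  linfty_jacobi : forall (N : nat) (d : 'I_N -> int) (x : 'I_N -> E),
    (0 < N)%N -> (forall i, gr (d i) (x i)) ->
    \sum_(1 <= i < N.+1) \sum_(s : 'S_N | shuffle i s)
      koszul d s *: l (l (take i (perm_seq x s)) :: drop i (perm_seq x s)) = 0 }.

(* The Maurer-Cartan series is required to be a finite sum. *)
Definition maurer_cartan (gr : int -> E -> Prop) (l : seq E -> E) (a : E) : Prop :=
  gr 0 a /\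
  exists2 n : nat, (forall k, (n < k)%N -> l (nseq k a) = 0) &
    \sum_(1 <= k < n.+1) (k`!%:R : K)^-1 *: l (nseq k a) = 0.

End Linfty.

Section QuasiTwilled.
Variables (K : fieldType) (A B : lmodType K).

Record quasi_twilled := QuasiTwilled {
  qmul : {bilinear (A * B)%type -> (A * B)%type -> (A * B)%type};
  qmulA : associative qmul;
  qmul_subalgebra : forall x y : B, (qmul (0, x) (0, y)).1 = 0 }.

Variable Q : quasi_twilled.

Definition amul (a b : A) : A := (qmul Q (a, 0) (b, 0)).1.
Definition bmul (x y : B) : B := (qmul Q (0, x) (0, y)).2.
(* a |> y *)
Definition ltri (a : A) (y : B) : B := (qmul Q (a, 0) (0, y)).2.
(* x <| b *)
Definition rtri (x : B) (b : A) : B := (qmul Q (0, x) (b, 0)).2.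
(* x -> b (right harpoon) *)
Definition rharp (x : B) (b : A) : A := (qmul Q (0, x) (b, 0)).1.
(* a <- y (left harpoon) *)
Definition lharp (a : A) (y : B) : A := (qmul Q (a, 0) (0, y)).1.
Definition theta (a b : A) : B := (qmul Q (a, 0) (b, 0)).2.

Lemma qmulE a x b y : qmul Q (a, x) (b, y) =
  (amul a b + lharp a y + rharp x b,
   bmul x y + ltri a y + rtri x b + theta a b).
Proof.
have spl (c : A) (z : B) : (c, z) = (c, 0) + (0, z).
  by congr pair; rewrite /= ?addr0 ?add0r.
rewrite (spl a x) (spl b y) linearDl /= !linearDr /=.
rewrite /amul /lharp /rharp /bmul /ltri /rtri /theta.
have := qmul_subalgebra Q x y.
case: (qmul Q (a, 0) (b, 0)) (qmul Q (a, 0) (0, y)) (qmul Q (0, x) (b, 0))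
  (qmul Q (0, x) (0, y)) => [? ?] [? ?] [? ?] [? ?] /= ->.
congr pair; first by rewrite /= addr0.
rewrite /= [LHS]addrC -!addrA addrCA; congr (_ + _).
by rewrite [LHS]addrA [LHS]addrC.
Qed.

Definition strong_deformation (D : {linear A -> B}) : Prop :=
  forall a b, D (amul a b + lharp a (D b) + rharp (D a) b) =
    bmul (D a) (D b) + ltri a (D b) + rtri (D a) b + theta a b.

Definition mu_fun (u v : A * B) : A * B :=
  (amul u.1 v.1, ltri u.1 v.2 + rtri u.2 v.1).

Definition nu_fun (u v : A * B) : A * B :=
  (lharp u.1 v.2 + rharp u.2 v.1, bmul u.2 v.2).

Let inA_linear c (a b : A) : (c *: a + b, 0 : B) = c *: (a, 0) + (b, 0).
Proof. by congr pair; rewrite /= ?scaler0 ?addr0. Qed.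

Let inB_linear c (a b : B) : (0 : A, c *: a + b) = c *: (0, a) + (0, b).
Proof. by congr pair; rewrite /= ?scaler0 ?addr0. Qed.

Lemma mu_bilinear : bilinear_for *:%R *:%R mu_fun.
Proof.
by split=> w c u v; rewrite /mu_fun /amul /ltri /rtri /= !inA_linear !inB_linear
  ?linearPl ?linearPr; congr pair; rewrite //= scalerDr addrACA.
Qed.

Lemma nu_bilinear : bilinear_for *:%R *:%R nu_fun.
Proof.
by split=> w c u v; rewrite /nu_fun /bmul /lharp /rharp /= !inA_linear !inB_linear
  ?linearPl ?linearPr; congr pair; rewrite //= scalerDr addrACA.
Qed.

HB.instance Definition _ := bilinear_isBilinear.Build K (A * B)%type (A * B)%type
  (A * B)%type *:%R *:%R mu_fun mu_bilinear.
HB.instance Definition _ := bilinear_isBilinear.Build K (A * B)%type (A * B)%type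
  (A * B)%type *:%R *:%R nu_fun nu_bilinear.

Definition mu_cochain : cochain (A * B)%type (A * B)%type := bilin_cochain mu_fun.
Definition nu_cochain : cochain (A * B)%type (A * B)%type := bilin_cochain nu_fun.

(* Extension by zero of maps from A to B to maps of A + B. *)
Definition ext_fun (f : seq A -> B) (s : seq (A * B)) : A * B :=
  (0, f [seq u.1 | u <- s]).

Lemma ext_funP (f : cochain A B) :
  ext_fun f \in @cochain_pred K (A * B)%type (A * B)%type.
Proof.
apply/asboolP; split; rewrite /ext_fun.
- move=> s1 s2 c u v; rewrite !map_cat /= cochain_multilinear.
  by congr pair; rewrite /= scaler0 addr0.
- by rewrite /= cochain_nil.
- by have [N fN] := cochain_bounded f; exists N => s hs; rewrite fN // size_map.
Qed.

Definition ext (f : cochain A B) : cochain (A * B)%type (A * B)%type :=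
  Cochain (ext_funP f).

(* The left inverse of [ext]: restriction to A followed by projection to B. *)
Definition res_fun (F : seq (A * B) -> A * B) (s : seq A) : B :=
  (F [seq (a, 0) | a <- s]).2.

Lemma res_funP (F : cochain (A * B)%type (A * B)%type) :
  res_fun F \in @cochain_pred K A B.
Proof.
apply/asboolP; split; rewrite /res_fun.
- by move=> s1 s2 c u v; rewrite !map_cat /= inA_linear cochain_multilinear.
- by rewrite /= cochain_nil.
- by have [N fN] := cochain_bounded F; exists N => s hs; rewrite fN // size_map.
Qed.

Definition res (F : cochain (A * B)%type (A * B)%type) : cochain A B :=
  Cochain (res_funP F).

Lemma extK : cancel ext res.
Proof.
move=> f; apply/val_inj/funext => s /=.
by rewrite /res_fun /= /ext_fun -map_comp map_id.
Qed.

(* [res] is only used to move brackets which are extensions by zero back to     *)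
(* [cochain A B].                                                               *)
Definition l1 (f : cochain A B) : cochain A B := res (gbracket mu_cochain (ext f)).

Definition l2 (f g : cochain A B) : cochain A B :=
  res (gbracket (gbracket nu_cochain (ext f)) (ext g)).

Definition lD (D : {linear A -> B}) (s : seq (cochain A B)) : cochain A B :=
  match s with
  | [:: f] => l1 f + l2 (lin_cochain D) f
  | [:: f; g] => l2 f g
  | _ => 0
  end.

End QuasiTwilled.

(* Main.v *)
Require Import Defs.
From HB Require Import structures.
From mathcomp Require Import all_boot all_order all_algebra all_fingroup.
From mathcomp Require Import boolp classical_sets functions.
From mathcomp Require Import zify ring.

(** The twisted operations are the untwisted ones of another algebra.  Transport
    the product of [A + B] along the automorphism [(a, x) |-> (a, x + D a)].  The
    graph of [D], which is a subalgebra because [D] is a strong deformation map,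
    becomes [A], so that the transported structure [twist Q D] has no component
    theta.  Its part [nu] is unchanged and its part [mu] is [mu + [nu, D]], so its
    operations [l1] and [l2] are those of the theorem ([lD_twist]); and [D + D'] is
    a strong deformation map of [Q] if and only if [D'] is one of [twist Q D]
    ([strong_deformation_twist]).  One may thus suppose that [theta = 0] and
    [D = 0].

    When [theta = 0] the product is [mu + nu], and [mu + t nu] is associative for
    every nonzero [t], being a rescaling of it.  Comparing the powers of [t] in the
    associator gives [[mu, mu] = [mu, nu] = [nu, nu] = 0] ([mu_nu_assoc]).  Then [l1]
    is the adjoint action of an element of square zero, and [l2] is the derived
    bracket of [nu] on an abelian subalgebra: graded symmetry, the Leibniz rule and
    the Jacobi identity follow from the graded Jacobi identity of the Gerstenhaber
    bracket ([derived_sym], [derived_leibniz], [derived_jacobi]).  Evaluating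
    [l1 D' + l2 (D', D') / 2] at two arguments gives the Maurer-Cartan part
    ([strong_deformation_dgL]).

    The graded Jacobi identity ([gbracket_jacobi]) comes from the pre-Lie identity
    [rcirc_commutator], proved by induction on the list of arguments: right
    composition with [f] and with [g] are operators whose graded commutator is right
    composition with [[f, g]].  That the brackets defining [l1] and [l2] are
    extensions of maps from [A] to [B], and that such extensions commute, comes from a
    filtration by the number of arguments in [B] ([gbracket_fil],
    [gbracket_fil0], [extK_fil]). *)

Set Implicit Arguments.
Unset Strict Implicit.
Unset Printing Implicit Defensive.

Import GRing.Theory.
Local Open Scope ring_scope.

(** * Identities in modules *)

Section ModuleExpressions.
Variables (K : fieldType) (V : lmodType K).

(** Formal linear combinations of indexed variables with coefficients in [K]. *)
Inductive mexpr := MVar of nat | MZero | MAdd of mexpr & mexpr | MOpp of mexpr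
  | MScale of K & mexpr.

(** The value of an expression when variable [n] denotes the [n]-th entry of [env]. *)
Fixpoint mval (env : seq V) (e : mexpr) : V :=
  match e with
  | MVar n => env`_n
  | MZero => 0
  | MAdd e1 e2 => mval env e1 + mval env e2
  | MOpp e1 => - mval env e1
  | MScale c e1 => c *: mval env e1
  end.

(** The coefficient of variable [i]. *)
Fixpoint mcoef (e : mexpr) (i : nat) : K :=
  match e with
  | MVar n => if Nat.eqb n i then 1 else 0
  | MZero => 0
  | MAdd e1 e2 => mcoef e1 i + mcoef e2 i
  | MOpp e1 => - mcoef e1 i
  | MScale c e1 => c * mcoef e1 i
  end.

Lemma mvalE env e : mval env e = \sum_(i < size env) mcoef e i *: env`_i.
Proof.
elim: e => [n||e1 IH1 e2 IH2|e1 IH1|c e1 IH1] /=.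
- have E i : (if Nat.eqb n i then 1 else 0) *: env`_i = if i == n then env`_n else 0.
    have -> : Nat.eqb n i = (i == n).
      by apply/idP/eqP => [/PeanoNat.Nat.eqb_eq|->//]; rewrite ?PeanoNat.Nat.eqb_refl.
    by case: eqP => [->|_]; rewrite ?scale1r ?scale0r.
  under eq_bigr do rewrite E.
  have [hn|hn] := ltnP n (size env).
    by rewrite -big_mkcond (big_pred1 (Ordinal hn)).
  rewrite nth_default // big1 // => i _; rewrite ifF //.
  by apply/eqP => hi; move: (ltn_ord i); rewrite hi ltnNge hn.
- by rewrite big1 // => i _; rewrite scale0r.
- by rewrite IH1 IH2 -big_split; apply: eq_bigr => i _; rewrite /= scalerDl.
- by rewrite IH1 -sumrN; apply: eq_bigr => i _; rewrite /= scaleNr.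
- by rewrite IH1 scaler_sumr; apply: eq_bigr => i _; rewrite /= scalerA.
Qed.

Fixpoint mcoefs_eq (e1 e2 : mexpr) (n : nat) : Prop :=
  if n is m.+1 then mcoef e1 m = mcoef e2 m /\ mcoefs_eq e1 e2 m else True.

Lemma mval_eq env e1 e2 :
  mcoefs_eq e1 e2 (size env) -> mval env e1 = mval env e2.
Proof.
move=> h; rewrite !mvalE; apply: eq_bigr => -[i hi] _ /=; congr (_ *: _).
elim: (size env) h i hi => [|n IH] //= [hn /IH h] i.
by rewrite ltnS leq_eqVlt => /predU1P[->|/h].
Qed.

End ModuleExpressions.

(** [module_with V] reduces an equality between linear combinations in the
    module [V] to the equality of the coefficients of each atom, and leaves these
    to [ring].  Atoms are compared syntactically. *)
Ltac minsert x env :=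
  lazymatch env with
  | [::] => constr:([:: x])
  | x :: _ => env
  | ?y :: ?r => let r' := minsert x r in constr:(y :: r')
  end.

Ltac matoms e env :=
  lazymatch e with
  | ?a + ?b => let env' := matoms a env in matoms b env'
  | - ?a => matoms a env
  | ?c *: ?a => matoms a env
  | 0 => env
  | _ => minsert e env
  end.

Ltac mindex x env :=
  lazymatch env with
  | x :: _ => constr:(0%N)
  | _ :: ?r => let n := mindex x r in constr:(S n)
  end.

Ltac mquote K e env :=
  lazymatch e with
  | ?a + ?b => let a' := mquote K a env in let b' := mquote K b env in
               constr:(@MAdd K a' b')
  | - ?a => let a' := mquote K a env in constr:(@MOpp K a')
  | ?c *: ?a => let a' := mquote K a env in constr:(@MScale K c a')
  | 0 => constr:(@MZero K)
  | _ => let n := mindex e env in constr:(@MVar K n)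
  end.

Tactic Notation "module_with" constr(V) :=
  lazymatch type of V with
  | GRing.Lmodule.type ?K =>
    lazymatch goal with
    | |- ?l = ?r =>
      let env := matoms l (@nil (GRing.Lmodule.sort V)) in
      let env := matoms r env in
      let l' := mquote K l env in
      let r' := mquote K r env in
      change (@mval K V env l' = @mval K V env r');
      apply: mval_eq; cbn [mcoefs_eq mcoef size Nat.eqb]; repeat split; try ring
    end
  end.

(** * The graded pre-Lie identity *)

Section PreLie.
Variables (K : fieldType) (V : lmodType K).
Implicit Types (f g h : seq V -> V) (s t : seq V) (a : V).

(** [rcirc q h g] is the composition of [h] with the component of [g] with
    [q + 1] arguments, for any number of arguments of [h]: the number of summands is
    read off the length of the list, so that [h] need not be homogeneous.  For
    fixed [g] it is an operator acting on [h] from the right. *)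
Definition rcirc (q : nat) (h g : seq V -> V) (s : seq V) : V :=
  \sum_(i < size s - q) (-1) ^+ (i * q) *: insert_at i q h g s.

(** The summand of [rcirc] where [g] is inserted in the first position. *)
Definition fst_insert (q : nat) (h g : seq V -> V) (s : seq V) : V :=
  if (q < size s)%N then h (g (take q.+1 s) :: drop q.+1 s) else 0.

(** The recursion on the list of arguments which drives the inductions below. *)
Lemma rcirc_cons q h g a t :
  rcirc q h g (a :: t) = fst_insert q h g (a :: t)
    + (-1) ^+ q *: rcirc q (fun t' => h (a :: t')) g t.
Proof.
rewrite /rcirc /fst_insert /= ltnS; have [hq|hq] := leqP q (size t).
  rewrite subSn // big_ord_recl mul0n expr0 scale1r; congr (_ + _).
  by rewrite scaler_sumr; apply: eq_bigr => i _; rewrite scalerA -exprD -mulSn.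
have -> : ((size t).+1 - q = 0)%N by lia.
have -> : (size t - q = 0)%N by lia.
by rewrite !big_ord0 scaler0 addr0.
Qed.

Lemma rcirc_comb c q h h' g s :
  rcirc q (fun t => h t + c *: h' t) g s = rcirc q h g s + c *: rcirc q h' g s.
Proof.
rewrite /rcirc scaler_sumr -big_split; apply: eq_bigr => i _ /=.
by rewrite /insert_at scalerDr !scalerA mulrC.
Qed.

Lemma multilinear_cons (h : seq V -> V) a :
  multilinear h -> multilinear (fun t => h (a :: t)).
Proof. by move=> hm s1 s2 c u v; rewrite -!cat_cons hm. Qed.

Lemma multilinear_sum (h : seq V -> V) s1 s2 (I : Type) (r : seq I)
    (c : I -> K) (x : I -> V) :
  multilinear h ->
  h (s1 ++ (\sum_(i <- r) c i *: x i) :: s2) =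
  \sum_(i <- r) c i *: h (s1 ++ x i :: s2).
Proof.
move=> hm; elim: r => [|i r IH].
  have := hm s1 s2 1 0 0; rewrite !big_nil !scale1r addr0 => /eqP.
  by rewrite addrC -subr_eq subrr eq_sym => /eqP.
by rewrite !big_cons hm IH.
Qed.

Lemma rcirc_comb_r c q h g g' s : multilinear h ->
  rcirc q h (fun t => g t + c *: g' t) s = rcirc q h g s + c *: rcirc q h g' s.
Proof.
move=> hm; rewrite /rcirc scaler_sumr -big_split; apply: eq_bigr => i _ /=.
rewrite /insert_at (addrC (g _)) hm addrC scalerDr !scalerA; congr (_ + _ *: _).
by rewrite mulrC.
Qed.

Lemma rcirc_short q h g s : (size s <= q)%N -> rcirc q h g s = 0.
Proof. by move=> hs; rewrite /rcirc (eqP hs) big_ord0. Qed.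

(** If [f] stands in the first position of [h], then [g] is inserted either in one
    of the arguments of [f], or in a later argument of [h]. *)
Lemma rcirc_fst_insert p q (h f g : seq V -> V) a t : multilinear h ->
  fst_insert q (fst_insert p h f) g (a :: t)
   + (-1) ^+ q *: rcirc q (fun t' => fst_insert p h f (a :: t')) g t
  = fst_insert (p + q) h (rcirc q f g) (a :: t)
   + (-1) ^+ (q + p * q) *: rcirc q (fun t' => h (f (take p.+1 (a :: t)) :: t')) g
       (drop p.+1 (a :: t)).
Proof.
move=> hm; have [hpq|hpq] := leqP (p + q) (size t); last first.
  rewrite [fst_insert (p + q) _ _ _]/fst_insert /= ltnS leqNgt hpq /= add0r.
  rewrite [X in _ = _ *: X]rcirc_short ?scaler0; last by rewrite size_drop; lia.
  have -> : fst_insert q (fst_insert p h f) g (a :: t) = 0.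
    rewrite /fst_insert /= size_drop; case: ifP => // hq.
    by rewrite ifF //; lia.
  rewrite add0r [rcirc _ _ _ _]big1 ?scaler0 // => i _.
  rewrite /insert_at /fst_insert ifF ?scaler0 //=.
  rewrite size_cat /= size_drop size_take; case: ifP; have := ltn_ord i; lia.
rewrite [fst_insert (p + q) _ _ _]/fst_insert /= ltnS hpq.
have -> : rcirc q f g (a :: take (p + q) t) =
  \sum_(i < p.+1) (-1) ^+ (i * q) *: insert_at i q f g (a :: take (p + q) t).
  by rewrite /rcirc /= size_takel // subSn ?leq_addl // addnK.
rewrite (multilinear_sum [::]) //= big_ord_recl mul0n expr0 scale1r -addrA.
congr (_ + _).
  rewrite /fst_insert /= size_drop.
  rewrite ifT; last by lia.
  rewrite ifT; last by lia.
  rewrite /insert_at /= drop_drop take_drop take_takel //.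
  by rewrite leq_addl.
(* [g] is inserted in an argument of [f] in the first [p] summands, and after [f]
   in the others. *)
rewrite {1}/rcirc.
have e : (size t - q = p + (size t - q - p))%N by lia.
rewrite e big_split_ord /= scalerDr; congr (_ + _).
  rewrite scaler_sumr; apply: eq_bigr => i _.
  rewrite scalerA -exprD -mulSn; congr (_ *: _).
  have hi := ltn_ord i.
  have hit : (i <= size t)%N by lia.
  rewrite /insert_at /fst_insert /= add0n size_cat /= size_takel //.
  rewrite size_drop ifT; last by lia.
  rewrite take_cat drop_cat size_takel // ltnNge (ltnW hi) /=.
  rewrite -(subnSK hi) /= drop_drop !take_drop take_takel; last by lia.
  rewrite take_takel; last by lia.
  have -> : (p - i.+1 + (i + q.+1) = p + q)%N by lia.
  by [].
rewrite /rcirc size_drop.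
have -> : (size t - q - p = size t - p - q)%N by lia.
rewrite !scaler_sumr; apply: eq_bigr => i _.
have hi := ltn_ord i.
rewrite !scalerA -!exprD mulnDl addnA; congr (_ *: _).
have hpi : (p + i <= size t)%N by lia.
rewrite /insert_at /fst_insert /= size_cat /= size_takel //.
rewrite size_drop ifT; last by lia.
rewrite takel_cat ?size_takel ?leq_addr // take_takel ?leq_addr //.
have -> : drop p (take (p + i) t ++ g (take q.+1 (drop (p + i) t)) :: drop (p + i + q.+1) t)
   = drop p (take (p + i) t) ++ g (take q.+1 (drop (p + i) t)) :: drop (p + i + q.+1) t.
  rewrite drop_cat size_takel //; case: ltnP => // hip.
  have -> : (p - (p + i) = 0)%N by lia.
  by rewrite drop0 [drop p _]drop_oversize // size_takel.
by rewrite !drop_drop !take_drop (addnC p i) [(i + q.+1 + p)%N]addnAC.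
Qed.

(** The graded pre-Lie identity: the graded commutator of the operators given by
    [f] and [g] is the operator given by their bracket.  Insertions of [f] and [g]
    in two different arguments of [h] occur in both orders and cancel; the others
    are insertions of one map into the other. *)
Lemma rcirc_commutator p q (h f g : seq V -> V) s : multilinear h ->
  rcirc q (rcirc p h f) g s - (-1) ^+ (p * q) *: rcirc p (rcirc q h g) f s
  = rcirc (p + q) h (rcirc q f g) s
    - (-1) ^+ (p * q) *: rcirc (p + q) h (rcirc p g f) s.
Proof.
elim: s h => [|a t IH] h hm; first by rewrite !rcirc_short.
have E (r r' : nat) (f' g' : seq V -> V) :
    rcirc r (rcirc r' h f') g' (a :: t) = fst_insert (r' + r) h (rcirc r f' g') (a :: t)
      + (-1) ^+ (r + r' * r) *: rcirc r (fun t' => h (f' (take r'.+1 (a :: t)) :: t')) g'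
           (drop r'.+1 (a :: t))
      + (-1) ^+ r' *: rcirc r' (fun t' => h (g' (take r.+1 (a :: t)) :: t')) f'
           (drop r.+1 (a :: t))
      + (-1) ^+ (r' + r) *: rcirc r (rcirc r' (fun t' => h (a :: t')) f') g' t.
  rewrite rcirc_cons -rcirc_fst_insert //.
  have -> : (fun t' => rcirc r' h f' (a :: t')) = (fun t' => fst_insert r' h f' (a :: t')
      + (-1) ^+ r' *: rcirc r' (fun t'' => h (a :: t'')) f' t').
    by apply/funext => t'; rewrite rcirc_cons.
  rewrite rcirc_comb scalerDr scalerA -exprD (addnC r r') !addrA; congr (_ + _).
  rewrite -!addrA addrC [RHS]addrC -!addrA; congr (_ + _).
  rewrite addrC /fst_insert /=; case: ifP => hr; first by rewrite rcirc_cons.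
  by rewrite rcirc_short ?scaler0 ?addr0 // size_drop; lia.
rewrite !E (mulnC q p) !rcirc_cons.
have := IH (fun t' => h (a :: t')) (multilinear_cons a hm).
rewrite (addnC q p) => /(canRL (subrK _)) ->.
(* Every exponent matters only through its parity, so that the signs become
   explicit once the parities of the degrees are known. *)
rewrite -!(signr_odd _ (_ + _)) -!(signr_odd _ (_ * _)).
rewrite -!(signr_odd _ p) -!(signr_odd _ q).
rewrite !oddD !oddM.
by case: (odd p); case: (odd q); rewrite /= ?expr0 ?expr1; module_with V.
Qed.
End PreLie.

(** * The Gerstenhaber bracket is a graded Lie bracket *)

Lemma cochainE (K : fieldType) (U W : lmodType K) c (f g : cochain U W) s :
  (c *: f + g) s = c *: f s + g s.
Proof. by []. Qed.

Lemma cochainP (K : fieldType) (U W : lmodType K) (f g : cochain U W) :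
  (forall s, f s = g s) -> f = g.
Proof. by move=> fg; apply/val_inj/funext. Qed.

Section GradedLie.
Variables (K : fieldType) (V : lmodType K).
Implicit Types (f g k : cochain V V) (s t : seq V).

Lemma insert_at_comb_r (h : cochain V V) i q (g g' : seq V -> V) c s :
  insert_at i q h (fun t => c *: g t + g' t) s =
  c *: insert_at i q h g s + insert_at i q h g' s.
Proof. exact: cochain_multilinear. Qed.

Lemma circ_comb_l p q (h h' : seq V -> V) g c s :
  circ p q (fun t => c *: h t + h' t) g s = c *: circ p q h g s + circ p q h' g s.
Proof.
rewrite /circ scaler_sumr -big_split; apply: eq_bigr => i _ /=.
by rewrite /insert_at scalerDr !scalerA mulrC.
Qed.

Lemma circ_comb_r p q (h : cochain V V) (g g' : seq V -> V) c s :
  circ p q h (fun t => c *: g t + g' t) s = c *: circ p q h g s + circ p q h g' s.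
Proof.
rewrite /circ scaler_sumr -big_split; apply: eq_bigr => i _ /=.
by rewrite insert_at_comb_r scalerDr !scalerA mulrC.
Qed.

Lemma gbracket_bilinear : bilinear_for *:%R *:%R (@gbracket K V).
Proof.
split=> g c f f'; apply: cochainP => s; rewrite !cochainE /= /gbracket_fun;
  rewrite scaler_sumr -big_split; apply: eq_bigr => p _ /=;
  rewrite scaler_sumr -big_split; apply: eq_bigr => q _ /=;
  rewrite /gbracket_hom circ_comb_l circ_comb_r; module_with V.
Qed.

HB.instance Definition _ := bilinear_isBilinear.Build K (cochain V V) (cochain V V)
  (cochain V V) *:%R *:%R (@gbracket K V) gbracket_bilinear.

(** [f] is concentrated in degree [n], that is, on lists of length [n + 1]. *)
Definition homog (U W : lmodType K) (n : nat) (f : seq U -> W) : Prop :=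
  forall s : seq U, size s != n.+1 -> f s = 0.

Lemma size_insert i q (x : V) s : (i + q < size s)%N ->
  size (take i s ++ x :: drop (i + q.+1) s) = (size s - q)%N.
Proof. by move=> h; rewrite size_cat /= size_drop size_takel; lia. Qed.

Lemma circ_homog0 p q p' q' f g s : homog p f -> homog q g ->
  (p' + q').+1 = size s -> (p', q') != (p, q) -> circ p' q' f g s = 0.
Proof.
move=> hf hg hs hpq; rewrite /circ big1 // => i _; rewrite /insert_at.
have hi := ltn_ord i.
have [ep|np] := eqVneq p' p; last by rewrite hf ?scaler0 // size_insert; lia.
rewrite hg ?cochain0 ?scaler0 // size_takel ?size_drop; last by lia.
by move: hpq; rewrite ep xpair_eqE eqxx.
Qed.

Lemma rcircE p q (f g : seq V -> V) s : size s = (p + q).+1 -> rcirc q f g s = circ p q f g s.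
Proof. by move=> hs; rewrite /rcirc hs subSn ?leq_addl // addnK. Qed.

Lemma rcirc_homog p q (f : seq V -> V) g : homog p f -> homog (p + q) (rcirc q f g).
Proof.
move=> hf s hs; rewrite /rcirc big1 // => i _; have hi := ltn_ord i.
by rewrite /insert_at hf ?scaler0 // size_insert; lia.
Qed.

(** On homogeneous cochains the double sum defining the bracket reduces to the
    graded commutator of [rcirc], on lists of any length. *)
Lemma gbracketE p q f g s : homog p f -> homog q g ->
  gbracket f g s = rcirc q f g s - (-1) ^+ (p * q) *: rcirc p g f s.
Proof.
move=> hf hg; rewrite /= /gbracket_fun.
have Z p' q' : (p' + q').+1 == size s -> (p', q') != (p, q) ->
    gbracket_hom p' q' f g s = 0.
  move=> /eqP hs hpq; rewrite /gbracket_hom (circ_homog0 hf hg) //.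
  rewrite (circ_homog0 hg hf) ?scaler0 ?subr0 //; first by rewrite addnC.
  by move: hpq; rewrite !xpair_eqE andbC.
have [hs|hs] := eqVneq (size s) (p + q).+1; last first.
  rewrite (rcirc_homog _ hf) // (rcirc_homog _ hg) 1?addnC // scaler0 subr0.
  apply: big1 => p' _; apply: big1 => q' hq'; apply: Z => //.
  by apply: contra hs => /eqP[<- <-]; rewrite eq_sym.
rewrite (rcircE _ _ hs) (@rcircE q p) 1?addnC //.
have hp : (p < size s)%N by lia.
have hq : (q < size s)%N by lia.
rewrite (bigD1 (Ordinal hp)) //= (bigD1 (Ordinal hq)) /= ?hs //.
rewrite big1 => [|q' /andP[hq' nq]]; last first.
  by rewrite Z ?hs //; apply: contra nq => /eqP[e]; apply/eqP/val_inj.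
rewrite big1 ?addr0 // => p' np; apply: big1 => q' hq'.
by rewrite Z ?hs //; apply: contra np => /eqP[e _]; apply/eqP/val_inj.
Qed.

Lemma gbracket_homog p q f g : homog p f -> homog q g -> homog (p + q) (gbracket f g).
Proof.
move=> hf hg s hs; rewrite (gbracketE s hf hg) (rcirc_homog _ hf) //.
by rewrite (rcirc_homog _ hg) ?scaler0 ?subr0 1?addnC.
Qed.

(** Graded antisymmetry. *)
Lemma gbracketC p q f g : homog p f -> homog q g ->
  gbracket f g = - ((-1) ^+ (p * q) *: gbracket g f).
Proof.
move=> hf hg; apply: cochainP => s; rewrite -[RHS]/(- ((-1) ^+ (p * q) *: gbracket g f s)).
rewrite (gbracketE s hf hg) (gbracketE s hg hf) (mulnC q p).
by rewrite -!(signr_odd _ (_ * _)); case: (odd _); rewrite /= ?expr0 ?expr1; module_with V.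
Qed.

(** The graded Jacobi identity: by the pre-Lie identity, each of the three brackets is
    a combination of four iterated compositions of the form
    [rcirc _ (rcirc _ x y) z]. *)
Lemma gbracket_jacobi p q r f g k : homog p f -> homog q g -> homog r k ->
  gbracket (gbracket f g) k =
  gbracket f (gbracket g k) + (-1) ^+ (q * r) *: gbracket (gbracket f k) g.
Proof.
move=> hf hg hk; apply: cochainP => s.
have C p' q' r' (f' g' k' : cochain V V) : homog p' f' -> homog q' g' -> homog r' k' ->
   gbracket (gbracket f' g') k' s =
    rcirc r' (rcirc q' f' g') k' s
    - (-1) ^+ (p' * q') *: rcirc r' (rcirc p' g' f') k' s
    - (-1) ^+ ((p' + q') * r') *: (rcirc q' (rcirc p' k' f') g' s
      - (-1) ^+ (p' * q') *: rcirc p' (rcirc q' k' g') f' s).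
  move=> hf' hg' hk'; rewrite (gbracketE s (gbracket_homog hf' hg') hk').
  have -> : (gbracket f' g' : seq V -> V) = 
     (fun t => rcirc q' f' g' t + - (-1) ^+ (p' * q') *: rcirc p' g' f' t).
    by apply/funext => t; rewrite (gbracketE t hf' hg') scaleNr.
  rewrite rcirc_comb (rcirc_comb_r _ _ _ _ _ (@cochain_multilinear _ _ _ k')) !scaleNr.
  by rewrite (rcirc_commutator p' q' f' g' s (@cochain_multilinear _ _ _ k')).
rewrite -[RHS]/(gbracket f (gbracket g k) s + (-1) ^+ (q * r) *: gbracket (gbracket f k) g s).
rewrite (gbracketC hf (gbracket_homog hg hk)).
rewrite -[X in _ = X + _]/(- ((-1) ^+ (p * (q + r)) *: gbracket (gbracket g k) f s)).
rewrite (C _ _ _ _ _ _ hf hg hk) (C _ _ _ _ _ _ hg hk hf) (C _ _ _ _ _ _ hf hk hg).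
rewrite -!(signr_odd _ (_ * _)) !oddM !oddD.
by case: (odd p); case: (odd q); case: (odd r); rewrite /= ?expr0 ?expr1; module_with V.
Qed.

End GradedLie.

(** * Derived brackets of elements of degree one *)

Section DegreeOne.
Variables (K : fieldType) (V : lmodType K).
Hypothesis char0 : [pchar K] =i pred0.
Implicit Types (f g k M N : cochain V V).
Local Notation C := (cochain V V : lmodType K).

Lemma natS_neq0 n : (n.+1%:R : K) != 0.
Proof. by rewrite ((pcharf0P K).1 char0). Qed.

Lemma scale2_eq0 (W : lmodType K) (x : W) : x + x = 0 -> x = 0.
Proof.
rewrite -mulr2n -scaler_nat => /eqP; rewrite scaler_eq0 (negPf (natS_neq0 1)).
by move/eqP.
Qed.

(** Elements of degree 1 which commute have anticommuting adjoint actions. *)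
Lemma ad_anticomm M N p f : homog 1 M -> homog 1 N -> homog p f ->
  gbracket M N = 0 -> gbracket M (gbracket N f) = - gbracket N (gbracket M f).
Proof.
move=> hM hN hf MN; apply/eqP; rewrite -addr_eq0; apply/eqP.
have := gbracket_jacobi hM hN hf; rewrite MN linear0l mul1n.
rewrite (gbracketC (gbracket_homog hM hf) hN) muln1 add1n exprS => ->.
by rewrite -(signr_odd _ p); case: (odd p); rewrite /= ?expr0 ?expr1; module_with C.
Qed.

Lemma ad_square M p f : homog 1 M -> homog p f -> gbracket M M = 0 ->
  gbracket M (gbracket M f) = 0.
Proof.
move=> hM hf MM; apply: scale2_eq0.
by rewrite {1}(ad_anticomm hM hM hf MM) addNr.
Qed.

(** [M] acts as a differential and [N] gives the derived bracket [m f g] = [[N, f], g];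
    the three lemmas are the symmetry, the Leibniz rule and the Jacobi identity of
    the latter. *)
Section Derived.
Variables (M N : cochain V V).
Hypotheses (hM : homog 1 M) (hN : homog 1 N).
Hypotheses (MN : gbracket M N = 0) (NN : gbracket N N = 0).

Local Notation m f g := (gbracket (gbracket N f) g).

Lemma derived_sym p q f g : homog p f -> homog q g -> gbracket f g = 0 ->
  m f g = (-1) ^+ (p * q) *: m g f.
Proof. by move=> hf hg fg; rewrite (gbracket_jacobi hN hf hg) fg linear0r add0r. Qed.

Lemma derived_leibniz p q f g : homog p f -> homog q g ->
  gbracket M (m f g) + m (gbracket M f) g + (-1) ^+ p *: m f (gbracket M g) = 0.
Proof.
move=> hf hg.
have hNf := gbracket_homog hN hf; have hMg := gbracket_homog hM hg.
have /esym/(canRL (addrK _)) -> := gbracket_jacobi hM hNf hg.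
rewrite (gbracketC hMg hNf) (ad_anticomm hM hN hf MN) linearNl.
rewrite -!(signr_odd _ (_ * _)) -!(signr_odd _ p) !oddM !oddD.
by case: (odd p); case: (odd q); rewrite /= ?expr0 ?expr1; module_with C.
Qed.

(** Since [ad N] squares to zero, [N, m f g] is up to sign the bracket of
    [N, f] and [N, g]; bracketing with [k] and moving [k] inside both factors gives
    the two other terms of the identity. *)
Lemma derived_jacobi p q r f g k : homog p f -> homog q g -> homog r k ->
  gbracket f (m g k) = 0 -> gbracket g (m f k) = 0 ->
  m (m f g) k + (-1) ^+ (q * r) *: m (m f k) g
    + (-1) ^+ (p * (q + r)) *: m (m g k) f = 0.
Proof.
move=> hf hg hk fgk gfk.
have hNf := gbracket_homog hN hf; have hNg := gbracket_homog hN hg.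
have hmfk := gbracket_homog hNf hk; have hmgk := gbracket_homog hNg hk.
have e : gbracket N (m f g) = - ((-1) ^+ p *: gbracket (gbracket N f) (gbracket N g)).
  have /esym/(canRL (addrK _)) -> := gbracket_jacobi hN hNf hg.
  rewrite (ad_square hN hf NN) linear0l (gbracketC hNg hNf).
  rewrite -!(signr_odd _ (_ * _)) -!(signr_odd _ p) !oddM !oddD.
  by case: (odd p); case: (odd q); rewrite /= ?expr0 ?expr1; module_with C.
rewrite e linearNl linearZl_LR /= (gbracket_jacobi hNf hNg hk).
rewrite (derived_sym hf hmgk fgk) (gbracketC hmfk hNg) (derived_sym hg hmfk gfk).
rewrite -!(signr_odd _ (_ * _)) -!(signr_odd _ p) !oddM !oddD.
by case: (odd p); case: (odd q); case: (odd r); rewrite /= ?expr0 ?expr1; module_with C.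
Qed.

End Derived.
End DegreeOne.

(** * The filtration by arguments in B, and the brackets l1 and l2 *)

Section Filtration.
Variables (K : fieldType) (A B : lmodType K).
Local Notation V := (A * B)%type.
Implicit Types (F G : cochain V V) (f g : cochain A B) (s : seq V).

(** The number of entries which lie in [B]. *)
Definition countB (s : seq V) : nat := count (fun u => u.1 == 0) s.

(** [F] belongs to step [m] of the filtration by the number of arguments in [B]
    minus the number (0 or 1) of values in [B], shifted by one: [F] vanishes on more
    than [m] arguments in [B], and takes values in [B] on [m] or more of them.  Extensions
    of maps from [A] to [B] are exactly the elements of step 0. *)
Definition fil_le (m : nat) (F : seq V -> V) : Prop :=
  forall s, ((m < countB s)%N -> F s = 0) /\ ((m <= countB s)%N -> (F s).1 = 0).

(** Inserting [y] = G(...) adds one argument in [B] when [y] lies in [B].  The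
    bounds have no truncated subtraction, so that the case [m1 = m2 = 0] says that
    the insertion vanishes altogether. *)
Lemma insert_at_fil m1 m2 i q F G s : fil_le m1 F -> fil_le m2 G ->
  ((m1 + m2 <= countB s)%N -> insert_at i q F G s = 0) /\
  ((m1 + m2 <= (countB s).+1)%N -> (insert_at i q F G s).1 = 0).
Proof.
move=> hF hG; rewrite /insert_at; set y := G _.
have hs : countB s = (countB (take i s) + countB (take q.+1 (drop i s))
    + countB (drop (i + q.+1) s))%N.
  rewrite -[in LHS](cat_take_drop i s) -[in LHS](cat_take_drop q.+1 (drop i s)).
  by rewrite /countB !count_cat drop_drop addnA (addnC q.+1).
have [h|h] := ltnP m2 (countB (take q.+1 (drop i s))).
  by rewrite /y (hG _).1 // cochain0.
have hn : countB (take i s ++ y :: drop (i + q.+1) s) =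
    (countB (take i s) + (y.1 == 0%R) + countB (drop (i + q.+1) s))%N.
  by rewrite /countB count_cat /= addnA.
have hy : (m2 <= countB (take q.+1 (drop i s)))%N -> (y.1 == 0%R) = 1%N :> nat.
  by move=> hm; rewrite (hG _).2 ?eqxx.
by split=> hm; [apply: (hF _).1 | apply: (hF _).2]; rewrite hn;
  case: (ltnP (countB (take q.+1 (drop i s))) m2) => [|/hy ->]; lia.
Qed.

(** A property stable under linear combinations holds for the value of a bracket as
    soon as it holds for all insertions. *)
Lemma gbracket_ind (P : V -> Prop) F G s :
  P 0 -> (forall (c : K) u v, P u -> P v -> P (u + c *: v)) -> 
  (forall i q, P (insert_at i q F G s)) -> (forall i q, P (insert_at i q G F s)) ->
  P (gbracket F G s).
Proof.
move=> P0 PD PFG PGF.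
have PA u v : P u -> P v -> P (u + v) by move=> pu pv; rewrite -[v]scale1r; apply: PD.
have PZ c v : P v -> P (c *: v) by rewrite -[_ *: _]add0r => pv; apply: PD.
have circP p q F' G' : (forall i r, P (insert_at i r F' G' s)) -> P (circ p q F' G' s).
  by move=> h; apply: big_ind => // i _; apply: PZ.
apply: big_ind => // p _; apply: big_ind => // q _.
by rewrite /gbracket_hom -scaleNr; apply: PD; apply: circP.
Qed.

Lemma gbracket_fil m1 m2 m F G : fil_le m1 F -> fil_le m2 G -> (m1 + m2 = m.+1)%N ->
  fil_le m (gbracket F G).
Proof.
move=> hF hG hm s; split=> hs.
  apply: (@gbracket_ind (fun u => u = 0)) => // [c u v -> -> | i q | i q].
  - by rewrite scaler0 addr0.
  - by apply: (insert_at_fil i q s hF hG).1; rewrite hm.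
  - by apply: (insert_at_fil i q s hG hF).1; rewrite addnC hm.
apply: (@gbracket_ind (fun u => u.1 = 0)) => // [c u v /= -> -> | i q | i q].
- by rewrite scaler0 addr0.
- by apply: (insert_at_fil i q s hF hG).2; rewrite hm.
- by apply: (insert_at_fil i q s hG hF).2; rewrite addnC hm.
Qed.

Lemma gbracket_fil0 F G : fil_le 0 F -> fil_le 0 G -> gbracket F G = 0.
Proof.
move=> hF hG; apply: cochainP => s.
apply: (@gbracket_ind (fun u => u = 0)) => // [c u v -> -> | i q | i q].
- by rewrite scaler0 addr0.
- exact: (insert_at_fil i q s hF hG).1.
- exact: (insert_at_fil i q s hG hF).1.
Qed.

Lemma ext_fil f : fil_le 0 (ext f).
Proof.
move=> s; split=> // hs; rewrite /= /ext_fun.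
move: hs; rewrite -has_count => /hasP [u /path.splitPr [s1 s2]].
by rewrite map_cat /= => /eqP ->; rewrite cochain0.
Qed.

Lemma extK_fil F : fil_le 0 F -> ext (res F) = F.
Proof.
move=> hF; apply: cochainP => s; rewrite /= /ext_fun /res_fun -map_comp.
have H s1 : F (s1 ++ s) = F (s1 ++ [seq (u.1, 0) | u <- s]).
  elim: s s1 => [|[a x] s IH] s1 //=.
  have -> : (a, x) = 1 *: (a, 0) + (0, x).
    by rewrite scale1r; congr pair; rewrite /= ?addr0 ?add0r.
  rewrite cochain_multilinear scale1r [X in _ + X](hF _).1.
    by rewrite addr0 -!cat_rcons IH.
  by rewrite /countB count_cat /= eqxx addnS.
by rewrite (H [::]) /=; have := (hF [seq (u.1, 0) | u <- s]).2 isT; case: (F _) => [a x] /= ->.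
Qed.

Lemma ext_linear : linear (@ext K A B).
Proof. 
move=> c f g; apply: cochainP => s.
rewrite cochainE /= /ext_fun /=.
by congr pair; rewrite /= scaler0 addr0.
Qed.

HB.instance Definition _ := GRing.isLinear.Build K (cochain A B) (cochain V V) *:%R
  (@ext K A B) ext_linear.

Lemma res_linear : linear (@res K A B).
Proof. by move=> c F G; apply: cochainP => s. Qed.

HB.instance Definition _ := GRing.isLinear.Build K (cochain V V) (cochain A B) *:%R
  (@res K A B) res_linear.

Lemma ext_homog p f : homog p f -> homog p (ext f).
Proof. by move=> hf s hs; rewrite /= /ext_fun hf // size_map. Qed.

Lemma res_homog p F : homog p F -> homog p (res F).
Proof. by move=> hF s hs; rewrite /= /res_fun hF // size_map. Qed.

End Filtration.

Section Brackets.
Variables (K : fieldType) (A B : lmodType K) (Q : quasi_twilled A B).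
Local Notation V := (A * B)%type.
Implicit Types (f g k : cochain A B).

Lemma amul0l b : amul Q 0 b = 0. Proof. by rewrite /amul -[(0, 0)]/(0 : V) linear0l. Qed.
Lemma amul0r a : amul Q a 0 = 0. Proof. by rewrite /amul -[(0, 0)]/(0 : V) linear0r. Qed.
Lemma bmul0l y : bmul Q 0 y = 0. Proof. by rewrite /bmul -[(0, 0)]/(0 : V) linear0l. Qed.
Lemma bmul0r x : bmul Q x 0 = 0. Proof. by rewrite /bmul -[(0, 0)]/(0 : V) linear0r. Qed.
Lemma ltri0l y : ltri Q 0 y = 0. Proof. by rewrite /ltri -[(0, 0)]/(0 : V) linear0l. Qed.
Lemma ltri0r a : ltri Q a 0 = 0. Proof. by rewrite /ltri -[(0, 0)]/(0 : V) linear0r. Qed.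
Lemma rtri0l b : rtri Q 0 b = 0. Proof. by rewrite /rtri -[(0, 0)]/(0 : V) linear0l. Qed.
Lemma rtri0r x : rtri Q x 0 = 0. Proof. by rewrite /rtri -[(0, 0)]/(0 : V) linear0r. Qed.
Lemma lharp0l y : lharp Q 0 y = 0. Proof. by rewrite /lharp -[(0, 0)]/(0 : V) linear0l. Qed.
Lemma lharp0r a : lharp Q a 0 = 0. Proof. by rewrite /lharp -[(0, 0)]/(0 : V) linear0r. Qed.
Lemma rharp0l b : rharp Q 0 b = 0. Proof. by rewrite /rharp -[(0, 0)]/(0 : V) linear0l. Qed.
Lemma rharp0r x : rharp Q x 0 = 0. Proof. by rewrite /rharp -[(0, 0)]/(0 : V) linear0r. Qed.
Lemma theta0l b : theta Q 0 b = 0. Proof. by rewrite /theta -[(0, 0)]/(0 : V) linear0l. Qed.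
Lemma theta0r a : theta Q a 0 = 0. Proof. by rewrite /theta -[(0, 0)]/(0 : V) linear0r. Qed.

(** Each component of the product vanishes as soon as one argument does. *)
Definition mul0 := (amul0l, amul0r, bmul0l, bmul0r, ltri0l, ltri0r, rtri0l, rtri0r,
  lharp0l, lharp0r, rharp0l, rharp0r, theta0l, theta0r).

(** [mu_cochain] and [nu_cochain] have bidegree 0 and -1 in the count of values minus
    arguments in [B]. *)
Lemma mu_fil : fil_le 1 (mu_cochain Q).
Proof.
move=> [|[a x] [|[b y] [|w s]]] //=; rewrite /countB /= /mu_fun /=.
by case: (eqVneq a 0) => [->|_]; case: (eqVneq b 0) => [->|_];
  rewrite ?mul0 ?addr0; split.
Qed.

Lemma nu_fil : fil_le 2 (nu_cochain Q).
Proof.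
move=> [|[a x] [|[b y] [|w s]]] //=; rewrite /countB /= /nu_fun /=.
by case: (eqVneq a 0) => [->|_]; case: (eqVneq b 0) => [->|_];
  rewrite ?mul0 ?addr0; split.
Qed.

Lemma bilin_homog (U W : lmodType K) (m : {bilinear U -> U -> W}) : homog 1 (bilin_cochain m).
Proof. by move=> [|u [|v [|w s]]]. Qed.

Lemma lin_homog (U W : lmodType K) (D : {linear U -> W}) : homog 0 (lin_cochain D).
Proof. by move=> [|u [|v s]]. Qed.

Lemma ext_l1 f : ext (l1 Q f) = gbracket (mu_cochain Q) (ext f).
Proof. by apply: extK_fil; apply: (gbracket_fil mu_fil (ext_fil f)). Qed.

Lemma ext_l2 f g : ext (l2 Q f g) = gbracket (gbracket (nu_cochain Q) (ext f)) (ext g).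
Proof.
apply: extK_fil; apply: (@gbracket_fil _ _ _ 1 0 0 _ _ _ (ext_fil g)) => //.
exact: (gbracket_fil nu_fil (ext_fil f)).
Qed.

Lemma ext_abelian f g : gbracket (ext f) (ext g) = 0.
Proof. exact: gbracket_fil0 (ext_fil f) (ext_fil g). Qed.

Lemma ext_inj : injective (@ext K A B).
Proof. exact: can_inj (@extK K A B). Qed.

Lemma l1_homog p f : homog p f -> homog (1 + p) (l1 Q f).
Proof. by move=> hf; apply/res_homog/gbracket_homog/ext_homog/hf/bilin_homog. Qed.

Lemma l2_homog p q f g : homog p f -> homog q g -> homog (1 + p + q) (l2 Q f g).
Proof.
move=> hf hg; apply/res_homog/gbracket_homog/ext_homog/hg.
exact/gbracket_homog/ext_homog/hf/bilin_homog.
Qed.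

Lemma l1_linear : linear (l1 Q).
Proof. by move=> c f g; rewrite /l1 [ext _]linearP linearPr linearP. Qed.

Lemma l2_bilinear : bilinear_for *:%R *:%R (l2 Q).
Proof.
split=> g c f f'; rewrite /l2 linearP; last by rewrite linearPr linearP.
by rewrite linearPr linearPl linearP.
Qed.

HB.instance Definition _ := GRing.isLinear.Build K (cochain A B) (cochain A B) *:%R
  (l1 Q) l1_linear.
HB.instance Definition _ := bilinear_isBilinear.Build K (cochain A B) (cochain A B)
  (cochain A B) *:%R *:%R (l2 Q) l2_bilinear.

Lemma l2_sym p q f g : homog p f -> homog q g -> l2 Q f g = (-1) ^+ (p * q) *: l2 Q g f.
Proof.
move=> hf hg; apply: ext_inj; rewrite linearZ /= !ext_l2.
by rewrite (derived_sym (bilin_homog _) (ext_homog hf) (ext_homog hg)) // ext_abelian.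
Qed.

Lemma l2_jacobi (char0 : [pchar K] =i pred0) p q r f g k :
  gbracket (nu_cochain Q) (nu_cochain Q) = 0 ->
  homog p f -> homog q g -> homog r k ->
  l2 Q (l2 Q f g) k + (-1) ^+ (q * r) *: l2 Q (l2 Q f k) g
    + (-1) ^+ (p * (q + r)) *: l2 Q (l2 Q g k) f = 0.
Proof.
move=> NN hf hg hk; apply: ext_inj; rewrite !linearD !linearZ linear0 /= !ext_l2.
apply: (derived_jacobi char0 (bilin_homog _) NN (ext_homog hf) (ext_homog hg) (ext_homog hk));
  by rewrite -ext_l2 ext_abelian.
Qed.

Lemma l12_leibniz (char0 : [pchar K] =i pred0) p q f g :
  gbracket (mu_cochain Q) (nu_cochain Q) = 0 ->
  homog p f -> homog q g ->
  l1 Q (l2 Q f g) + l2 Q (l1 Q f) g + (-1) ^+ p *: l2 Q f (l1 Q g) = 0.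
Proof.
move=> MN hf hg; apply: ext_inj; rewrite !linearD linearZ linear0 /= !(ext_l1, ext_l2).
exact: (derived_leibniz (bilin_homog _) (bilin_homog _) MN (ext_homog hf) (ext_homog hg)).
Qed.

Lemma l1_square (char0 : [pchar K] =i pred0) p f :
  gbracket (mu_cochain Q) (mu_cochain Q) = 0 -> homog p f -> l1 Q (l1 Q f) = 0.
Proof.
move=> MM hf; apply: ext_inj; rewrite linear0 !ext_l1.
exact: (ad_square char0 (bilin_homog _) (ext_homog hf) MM).
Qed.

End Brackets.

(** * Vanishing brackets for theta = 0, and twisting by a deformation map *)

Section Bilinear.
Variables (K : fieldType) (V : lmodType K).
Implicit Types m : {bilinear V -> V -> V}.

Lemma gbracket_bilin m m' u v w :
  gbracket (bilin_cochain m) (bilin_cochain m') [:: u; v; w] =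
  m (m' u v) w - m u (m' v w) + (m' (m u v) w - m' u (m v w)).
Proof.
rewrite (gbracketE _ (bilin_homog m) (bilin_homog m')) /rcirc /= !big_ord_recl !big_ord0.
rewrite /insert_at /= !expr0 !expr1; module_with V.
Qed.

Lemma gbracket_bilin_eq0 m m' :
  (forall u v w, m (m' u v) w - m u (m' v w) + (m' (m u v) w - m' u (m v w)) = 0) ->
  gbracket (bilin_cochain m) (bilin_cochain m') = 0.
Proof.
move=> h; apply: cochainP => s; have hom := gbracket_homog (bilin_homog m) (bilin_homog m').
case: s => [|u [|v [|w [|x s]]]]; try by rewrite hom.
by rewrite gbracket_bilin h.
Qed.

End Bilinear.

Section MatchedPair.
Variables (K : fieldType) (A B : lmodType K) (Q : quasi_twilled A B).
Hypothesis char0 : [pchar K] =i pred0.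
Hypothesis theta0 : forall a b, theta Q a b = 0.
Local Notation V := (A * B)%type.
Local Notation mu := (mu_fun Q).
Local Notation nu := (nu_fun Q).

(** The automorphism of the space [A + B] which multiplies [B] by [t]. *)
Definition rescale (t : K) (u : V) : V := (u.1, t *: u.2).

(** Conjugating the product by [rescale t] multiplies by [t] its part [nu]. *)
Lemma qmul_rescale t u v :
  qmul Q (rescale t u) (rescale t v) = rescale t (mu u v + t *: nu u v).
Proof.
case: u v => a x [b y].
have e c (z : B) : (0 : A, c *: z) = c *: (0, z) by congr pair; rewrite /= scaler0.
have lharpZ : lharp Q a (t *: y) = t *: lharp Q a y by rewrite /lharp e linearZr_LR.
have rharpZ : rharp Q (t *: x) b = t *: rharp Q x b by rewrite /rharp e linearZl_LR.
have ltriZ : ltri Q a (t *: y) = t *: ltri Q a y by rewrite /ltri e linearZr_LR.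
have rtriZ : rtri Q (t *: x) b = t *: rtri Q x b by rewrite /rtri e linearZl_LR.
have bmulZ : bmul Q (t *: x) (t *: y) = t *: (t *: bmul Q x y).
  by rewrite /bmul !e linearZl_LR linearZr_LR.
rewrite /rescale /= qmulE theta0 lharpZ rharpZ ltriZ rtriZ bmulZ.
by congr pair => /=; [module_with A | module_with B].
Qed.

Lemma rescaled_assoc t : t != 0 ->
  associative (fun u v => mu u v + t *: nu u v).
Proof.
move=> t0 u v w.
have inj : injective (rescale t).
  move=> [a x] [b y] [-> h]; congr pair.
  by rewrite -[x](scalerK t0) h scalerK.
by apply: inj; rewrite -!qmul_rescale qmulA.
Qed.

(** The associator of [mu + t nu] is a polynomial [x + t y + t^2 z] in [t] which
    vanishes at [t = 1, -1, 2], hence has zero coefficients. *)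
Lemma mu_nu_assoc u v w :
  [/\ mu (mu u v) w - mu u (mu v w) = 0,
      mu (nu u v) w - mu u (nu v w) + (nu (mu u v) w - nu u (mu v w)) = 0 &
      nu (nu u v) w - nu u (nu v w) = 0].
Proof.
set x := (X in [/\ X = 0, _ & _]); set y := (X in [/\ _, X = 0 & _]).
set z := (X in [/\ _, _ & X = 0]).
have e t : t != 0 -> x + t *: y + t ^+ 2 *: z = 0.
  move=> /rescaled_assoc /(_ u v w) /eqP; rewrite eq_sym -subr_eq0 => /eqP <-.
  rewrite /x /y /z !(linearDl, linearDr) /= !(linearZl_LR, linearZr_LR) /=.
  module_with (V : lmodType K).
have e1 := e 1 (oner_neq0 K).
have e2 : x + -1 *: y + (-1) ^+ 2 *: z = 0 by apply: e; rewrite oppr_eq0 oner_neq0.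
have e3 := e 2%:R (natS_neq0 char0 1).
have y0 : y = 0.
  apply: (scale2_eq0 char0); rewrite -[RHS](subrr (0 : V)) -{1}e1 -e2.
  module_with (V : lmodType K).
move: e1 e3; rewrite y0 !scaler0 !addr0 => e1 e3.
have z0 : z = 0.
  apply/eqP; have /negPf n3 := natS_neq0 char0 2.
  have : 3%:R *: z = 0.
    rewrite -[RHS](subrr (0 : V)) -{1}e3 -e1; module_with (V : lmodType K).
  by move/eqP; rewrite scaler_eq0 n3.
by split=> //; move: e1; rewrite z0 scaler0 addr0.
Qed.

Lemma mu_mu0 : gbracket (mu_cochain Q) (mu_cochain Q) = 0.
Proof.
by apply: gbracket_bilin_eq0 => u v w; have [-> _ _] := mu_nu_assoc u v w; rewrite addr0.
Qed.

Lemma mu_nu0 : gbracket (mu_cochain Q) (nu_cochain Q) = 0.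
Proof. by apply: gbracket_bilin_eq0 => u v w; have [_ -> _] := mu_nu_assoc u v w. Qed.

Lemma nu_nu0 : gbracket (nu_cochain Q) (nu_cochain Q) = 0.
Proof.
by apply: gbracket_bilin_eq0 => u v w; have [_ _ ->] := mu_nu_assoc u v w; rewrite addr0.
Qed.

End MatchedPair.

Section Twist.
Variables (K : fieldType) (A B : lmodType K) (Q : quasi_twilled A B) (D : {linear A -> B}).
Local Notation V := (A * B)%type.

(** The automorphism [(a, x) |-> (a, x + D a)], which maps [A] to the graph of [D],
    and its inverse. *)
Definition shear (u : V) : V := (u.1, u.2 + D u.1).
Definition unshear (u : V) : V := (u.1, u.2 - D u.1).

Lemma unshearK : cancel unshear shear.
Proof. by case=> a x; rewrite /shear /= subrK. Qed.

Lemma shear_linear : linear shear.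
Proof.
move=> c [a x] [b y]; rewrite /shear /= linearP; congr pair => /=.
module_with B.
Qed.

Lemma unshear_linear : linear unshear.
Proof.
move=> c [a x] [b y]; rewrite /unshear /= linearP; congr pair => /=.
module_with B.
Qed.

HB.instance Definition _ := GRing.isLinear.Build K V V *:%R shear shear_linear.
HB.instance Definition _ := GRing.isLinear.Build K V V *:%R unshear unshear_linear.

(** The product transported by [shear]. *)
Definition twist_mul (u v : V) : V := unshear (qmul Q (shear u) (shear v)).

Lemma twist_mul_bilinear : bilinear_for *:%R *:%R twist_mul.
Proof.
by split=> w c u v; rewrite /twist_mul linearP ?linearPl ?linearPr linearP.
Qed.

HB.instance Definition _ := bilinear_isBilinear.Build K V V V *:%R *:%R twist_mul
  twist_mul_bilinear.

Lemma twist_mulA : associative twist_mul.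
Proof. by move=> u v w; rewrite /twist_mul !unshearK qmulA. Qed.

Lemma twist_subalgebra (x y : B) : (twist_mul (0, x) (0, y)).1 = 0.
Proof. by rewrite /twist_mul /shear /= linear0 !addr0 qmul_subalgebra. Qed.

(** The quasi-twilled algebra structure obtained by moving the graph of [D] to [A]. *)
Definition twist : quasi_twilled A B :=
  @QuasiTwilled K A B twist_mul twist_mulA twist_subalgebra.

(** [E] is a strong deformation map when its graph is closed under the product. *)
Lemma strong_deformationE (P : quasi_twilled A B) (E : {linear A -> B}) :
  strong_deformation P E <->
  forall a b, E (qmul P (a, E a) (b, E b)).1 = (qmul P (a, E a) (b, E b)).2.
Proof. by split=> h a b; have := h a b; rewrite qmulE. Qed.

Lemma strong_deformation_twist (E : {linear A -> B}) :
  strong_deformation Q (D \+ E) <-> strong_deformation twist E.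
Proof.
rewrite !strong_deformationE; split=> h a b; have := h a b;
  rewrite /= /twist_mul /unshear /shear /= !(addrC (E _) (D _)).
- by move=> <-; rewrite [RHS]addrC addKr.
- by move=> ->; rewrite [LHS]addrC subrK.
Qed.

Lemma theta_twist : strong_deformation Q D -> forall a b, theta twist a b = 0.
Proof.
move/strong_deformationE => h a b.
by rewrite /theta /= /twist_mul /unshear /shear /= !add0r h subrr.
Qed.

Lemma nu_twist : nu_cochain twist = nu_cochain Q.
Proof.
apply: cochainP => -[|[a x] [|[b y] [|w s]]] //=.
rewrite /nu_fun /bmul /lharp /rharp /= /twist_mul /unshear /shear /= !add0r !linear0 !addr0.
rewrite !qmulE /= !mul0 !addr0 !add0r !linear0 !addr0.
by [].
Qed.

Lemma gbracket_lin (F : cochain V V) u v : homog 1 F ->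
  gbracket F (ext (lin_cochain D)) [:: u; v] =
  F [:: (0, D u.1); v] + F [:: u; (0, D v.1)] - (0, D (F [:: u; v]).1).
Proof.
move=> hF; rewrite (gbracketE _ hF (ext_homog (lin_homog D))) /rcirc /=.
rewrite !big_ord_recl !big_ord0 /insert_at /= /ext_fun /=.
by rewrite !muln0 mul0n !expr0 !scale1r !addr0.
Qed.

Lemma amul_twist a b : amul twist a b = amul Q a b + lharp Q a (D b) + rharp Q (D a) b.
Proof. by rewrite {1}/amul /= /twist_mul /unshear /shear /= !add0r qmulE. Qed.

Lemma ltri_twist a y :
  ltri twist a y = bmul Q (D a) y + ltri Q a y - D (lharp Q a y).
Proof.
rewrite {1}/ltri /= /twist_mul /unshear /shear /= !linear0 !addr0 !add0r qmulE /=.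
by rewrite !mul0 !addr0 !add0r.
Qed.

Lemma rtri_twist x b :
  rtri twist x b = bmul Q x (D b) + rtri Q x b - D (rharp Q x b).
Proof.
rewrite {1}/rtri /= /twist_mul /unshear /shear /= !linear0 !addr0 !add0r qmulE /=.
by rewrite !mul0 !addr0 !add0r.
Qed.

(** This is what turns [l1] into the twisted differential. *)
Lemma mu_twist : mu_cochain twist =
  mu_cochain Q + gbracket (nu_cochain Q) (ext (lin_cochain D)).
Proof.
apply: cochainP => s.
have h := gbracket_homog (bilin_homog (nu_fun Q)) (ext_homog (lin_homog D)).
rewrite -[RHS]/(mu_cochain Q s + gbracket (nu_cochain Q) (ext (lin_cochain D)) s).
case: s => [|[a x] [|[b y] [|w s]]]; try by rewrite h // addr0.
rewrite gbracket_lin; last exact: bilin_homog.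
rewrite /= /mu_fun /nu_fun /= amul_twist ltri_twist rtri_twist !mul0.
rewrite [D (_ + _)]linearD; congr pair => /=.
  by rewrite subr0 !addr0 add0r -!addrA [lharp _ _ _ + _]addrC.
module_with B.
Qed.

Lemma l1_twist f : l1 twist f = l1 Q f + l2 Q (lin_cochain D) f.
Proof. by rewrite /l1 /l2 mu_twist linearDl linearD. Qed.

Lemma l2_twist f g : l2 twist f g = l2 Q f g.
Proof. by rewrite /l2 nu_twist. Qed.

End Twist.

(** * Permutations of at most three elements, and the grading *)

Section SmallPermutations.
Local Notation o0 := (ord0 : 'I_3).
Local Notation o1 := (lift ord0 ord0 : 'I_3).
Local Notation o2 := (lift ord0 (lift ord0 ord0) : 'I_3).

Lemma ord2P (P : 'I_2 -> Prop) : P ord0 -> P (lift ord0 ord0) -> forall i, P i.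
Proof.
by move=> p0 p1 [[|[|//]] h]; [move: p0 | move: p1]; congr P; apply: val_inj.
Qed.

Lemma ord3P (P : 'I_3 -> Prop) : P o0 -> P o1 -> P o2 -> forall i, P i.
Proof.
by move=> p0 p1 p2 [[|[|[|//]]] h]; [move: p0 | move: p1 | move: p2]; congr P; apply: val_inj.
Qed.

Lemma perm_seq1 (K : fieldType) (E : lmodType K) (x : 'I_1 -> E) s :
  perm_seq x s = [:: x (s ord0)].
Proof. by rewrite /perm_seq enum_ordSl /= (size0nil (size_enum_ord 0)). Qed.

Lemma perm_seq2 (K : fieldType) (E : lmodType K) (x : 'I_2 -> E) s :
  perm_seq x s = [:: x (s ord0); x (s (lift ord0 ord0))].
Proof. by rewrite /perm_seq !enum_ordSl /= (size0nil (size_enum_ord 0)). Qed.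

Lemma perm_seq3 (K : fieldType) (E : lmodType K) (x : 'I_3 -> E) s :
  perm_seq x s = [:: x (s o0); x (s o1); x (s o2)].
Proof. by rewrite /perm_seq !enum_ordSl /= (size0nil (size_enum_ord 0)). Qed.

Lemma size_perm_seq (K : fieldType) (E : lmodType K) N (x : 'I_N -> E) s :
  size (perm_seq x s) = N.
Proof. by rewrite size_map size_enum_ord. Qed.

Lemma signz (K : fieldType) (z : int) : (-1 : K) ^ z = (-1) ^+ `|z|%N.
Proof.
case: z => n //; rewrite NegzE -exprz_inv invrN1.
by rewrite abszN.
Qed.

Lemma koszul1 (K : fieldType) (d : 'I_1 -> int) s : koszul K d s = 1.
Proof.
by rewrite /koszul !big_ord_recl !big_ord0 big_mkcond !big_ord_recl big_ord0 /= !mulr1.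
Qed.

Lemma koszul2 (K : fieldType) (d : 'I_2 -> int) s :
  koszul K d s = if (s (lift ord0 ord0) < s ord0)%N
    then (-1) ^+ (`|d (s ord0)| * `|d (s (lift ord0 ord0))|) else 1.
Proof.
rewrite /koszul; under eq_bigr do rewrite big_mkcond.
by rewrite !big_ord_recl !big_ord0 /= !mulr1 !mul1r signz abszM.
Qed.

Lemma koszul3 (K : fieldType) (d : 'I_3 -> int) s :
  koszul K d s =
    (if (s o1 < s o0)%N then (-1) ^+ (`|d (s o0)| * `|d (s o1)|) else 1)
  * (if (s o2 < s o0)%N then (-1) ^+ (`|d (s o0)| * `|d (s o2)|) else 1)
  * (if (s o2 < s o1)%N then (-1) ^+ (`|d (s o1)| * `|d (s o2)|) else 1).
Proof.
rewrite /koszul; under eq_bigr do rewrite big_mkcond.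
by rewrite !big_ord_recl !big_ord0 /= !mulr1 !mul1r !signz !abszM.
Qed.

(** The transpositions and the cycle [0 -> 1 -> 2 -> 0] which list, with the
    identity, the shuffles of two and of three elements. *)
Definition swap2 : 'S_2 := tperm ord0 (lift ord0 ord0).
Definition swap12 : 'S_3 := tperm o1 o2.
Definition cycle3 : 'S_3 := (tperm o0 o1 * tperm o0 o2)%g.

Lemma swap2E : (swap2 ord0 = lift ord0 ord0) * (swap2 (lift ord0 ord0) = ord0).
Proof. by rewrite /swap2 tpermL tpermR. Qed.

Lemma swap12E : (swap12 o0 = o0) * (swap12 o1 = o2) * (swap12 o2 = o1).
Proof. by rewrite /swap12 tpermL tpermR tpermD. Qed.

Lemma cycle3E : (cycle3 o0 = o1) * (cycle3 o1 = o2) * (cycle3 o2 = o0).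
Proof.
rewrite /cycle3 !permM tpermL tpermR [tperm o0 o1 o2]tpermD // tpermR tpermL.
by rewrite tpermD.
Qed.

Lemma perm2P (s : 'S_2) : s = 1%g \/ s = swap2.
Proof.
have hne : s ord0 <> s (lift ord0 ord0) :> nat by move=> /val_inj/perm_inj.
have := ltn_ord (s ord0); have := ltn_ord (s (lift ord0 ord0)) => h1 h0.
have [e0|e0] : (s ord0 = 0 :> nat)%N \/ (s ord0 = 1 :> nat)%N by lia.
  left; apply/permP; apply: ord2P; rewrite perm1; apply: val_inj; rewrite /= /bump; lia.
right; apply/permP; apply: ord2P; rewrite swap2E; apply: val_inj; rewrite /= /bump; lia.
Qed.

Lemma shuffle_perm3P (s : 'S_3) : (s o0 < s o1)%N -> [\/ s = 1%g, s = swap12 | s = cycle3].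
Proof.
move=> lt01.
have h02 : s o0 <> s o2 :> nat by move=> /val_inj/perm_inj.
have h12 : s o1 <> s o2 :> nat by move=> /val_inj/perm_inj.
have := ltn_ord (s o0); have := ltn_ord (s o1); have := ltn_ord (s o2) => k2 k1 k0.
have [e|[e|e]] : (s o2 = 2 :> nat)%N \/ (s o2 = 1 :> nat)%N \/ (s o2 = 0 :> nat)%N by lia.
- apply: Or31; apply/permP; apply: ord3P; rewrite perm1; apply: val_inj; rewrite /= /bump; lia.
- apply: Or32; apply/permP; apply: ord3P; rewrite swap12E; apply: val_inj; rewrite /= /bump; lia.
- apply: Or33; apply/permP; apply: ord3P; rewrite cycle3E; apply: val_inj; rewrite /= /bump; lia.
Qed.

Lemma shuffle21 (s : 'S_2) : shuffle 1 s.
Proof.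
apply/forallP => j; apply/forallP => k; apply/implyP.
by case: j k => [[|[|j]] hj] [[|[|k]] hk].
Qed.

Lemma shuffle22 (s : 'S_2) : shuffle 2 s = (s ord0 < s (lift ord0 ord0))%N.
Proof.
apply/forallP/idP => [/(_ ord0)/forallP/(_ (lift ord0 ord0))/implyP -> // | h j].
apply/forallP; move: j; apply: ord2P; apply: ord2P => //=; rewrite ?h //.
Qed.

Lemma shuffle32 (s : 'S_3) : shuffle 2 s = (s o0 < s o1)%N.
Proof.
apply/forallP/idP => [/(_ o0)/forallP/(_ o1)/implyP -> // | h j].
by apply/forallP; move: j; apply: ord3P; apply: ord3P => //=; rewrite ?h.
Qed.

Lemma sum_shuffle21 (E : zmodType) (F : 'S_2 -> E) :
  \sum_(s : 'S_2 | shuffle 1 s) F s = F 1%g + F swap2.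
Proof.
rewrite (bigD1 1%g) ?shuffle21 //= (bigD1 swap2) /= ?shuffle21; last first.
  by apply/eqP => /permP /(_ ord0); rewrite swap2E perm1.
rewrite big1 ?addr0 // => s /andP[/andP[_ n1] n2].
by case: (perm2P s) n1 n2 => ->; rewrite eqxx.
Qed.

Lemma sum_shuffle22 (E : zmodType) (F : 'S_2 -> E) :
  \sum_(s : 'S_2 | shuffle 2 s) F s = F 1%g.
Proof.
rewrite (big_pred1 1%g) // => s; rewrite shuffle22 /=.
case: (perm2P s) => ->; first by rewrite !perm1 eqxx.
rewrite !swap2E /=; apply/esym/eqP => /permP /(_ ord0); by rewrite swap2E perm1.
Qed.

Lemma sum_shuffle32 (E : zmodType) (F : 'S_3 -> E) :
  \sum_(s : 'S_3 | shuffle 2 s) F s = F 1%g + F swap12 + F cycle3.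
Proof.
rewrite (bigD1 1%g) ?shuffle32 ?perm1 //=.
have n1 : swap12 != 1%g by apply/eqP => /permP /(_ o1); rewrite swap12E perm1.
have n2 : cycle3 != 1%g by apply/eqP => /permP /(_ o1); rewrite cycle3E perm1.
have n3 : cycle3 != swap12 by apply/eqP => /permP /(_ o0); rewrite cycle3E swap12E.
rewrite (bigD1 swap12) /= ?shuffle32 ?swap12E ?n1 //.
rewrite (bigD1 cycle3) /= ?shuffle32 ?cycle3E ?n2 ?n3 //.
rewrite big1 ?addr0 ?addrA // => s /andP[/andP[/andP[h m1] m2] m3].
by rewrite shuffle32 in h; case: (shuffle_perm3P h) m1 m2 m3 => ->; rewrite eqxx.
Qed.

End SmallPermutations.

Section Grading.
Variables (K : fieldType) (U W : lmodType K).
Implicit Types F : cochain U W.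

(** The component of degree [n] of a cochain; it is zero for negative [n]. *)
Definition component_fun (n : int) (F : seq U -> W) (s : seq U) : W :=
  if (size s)%:Z == n + 1 then F s else 0.

Lemma component_funP n F : component_fun n F \in @cochain_pred K U W.
Proof.
apply/asboolP; split; rewrite /component_fun.
- move=> s1 s2 c u v; rewrite !size_cat /=; case: ifP => _; first exact: cochain_multilinear.
  by rewrite scaler0 addr0.
- by rewrite cochain_nil if_same.
- by have [N FN] := cochain_bounded F; exists N => s /FN ->; rewrite if_same.
Qed.

Definition component n F : cochain U W := Cochain (component_funP n F).

Lemma component_deg n F : cochain_deg n (component n F).
Proof.
move=> s; rewrite /= /component_fun.
by have [->|] := eqVneq (size s : int) (n + 1); rewrite ?eqxx.
Qed.

Lemma cochain_sumE (I : Type) (r : seq I) (F : I -> cochain U W) s :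
  (\sum_(i <- r) F i) s = \sum_(i <- r) F i s.
Proof.
elim: r => [|i r IH]; first by rewrite !big_nil.
by rewrite !big_cons -IH.
Qed.

Lemma cochain_grading : is_grading (@cochain_deg K U W).
Proof.
split.
- by move=> n s; rewrite eqxx.
- move=> n c u v hu hv s; rewrite cochainE => h; have [us|us] := eqVneq (u s) 0.
    by apply: hv; move: h; rewrite us scaler0 add0r.
  exact: hu.
- move=> F; have [N FN] := cochain_bounded F.
  exists [seq n%:Z | n <- iota 0 N], (fun n => component n F); split=> [n|].
    exact: component_deg.
  apply: cochainP => s; rewrite cochain_sumE big_map /= /component_fun.
  case: s => [|a s]; first by rewrite cochain_nil big1 // => n _; rewrite if_same.
  have [h|h] := leqP (size (a :: s)) N; last first.
    by rewrite FN // big1 // => n _; rewrite if_same.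
  rewrite (bigD1_seq (size s)) ?iota_uniq ?mem_iota //= -addn1 PoszD eqxx.
  rewrite big1 ?addr0 // => n hn; rewrite ifF //; apply: contraNF hn.
  by rewrite (inj_eq (addIr _)) => /eqP [->].
- move=> r y hr hy hsum n hn; apply: cochainP => s.
  have [//|hs] := eqVneq (y n s) 0.
  have e := hy n s hs.
  have : (\sum_(m <- r) y m) s = 0 by rewrite hsum.
  rewrite cochain_sumE (bigD1_seq n) //= big1 ?addr0 // => m hm.
  apply/eqP; apply: contraNT hm => /(hy m).
  by rewrite e => /addIr ->.
Qed.

(** A cochain of negative degree is zero, hence homogeneous of any degree; the
    choice of [`|d|] keeps the parity, and so all the signs. *)
Lemma deg_homog d F : cochain_deg d F -> homog `|d|%N F.
Proof.
move=> hF s; apply: contraNeq => hs; have := hF s hs.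
case: s hs => [|a s]; first by rewrite cochain_nil eqxx.
by move=> _ /= e; apply/eqP; lia.
Qed.

Lemma homog_deg n F : homog n F -> cochain_deg n%:Z F.
Proof.
move=> hF s hs; have [->|h] := eqVneq (size s) n.+1; first by rewrite -addn1 PoszD.
by rewrite hF ?eqxx in hs.
Qed.

Lemma deg_neg d F : cochain_deg d F -> (d < 0)%R -> F = 0.
Proof.
move=> hF hd; apply: cochainP => s; have [//|hs] := eqVneq (F s) 0.
have := hF s hs; case: s hs => [|a s]; first by rewrite cochain_nil eqxx.
by move=> _ /=; lia.
Qed.

End Grading.

(** * The L-infinity algebra *)

Section MatchedLinfty.
Variables (K : fieldType) (A B : lmodType K) (Q : quasi_twilled A B).
Hypothesis char0 : [pchar K] =i pred0.
Hypothesis theta0 : forall a b, theta Q a b = 0.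
Local Notation E := (cochain A B).

(** The operations [l1] and [l2] without twist.  They form an L-infinity algebra
    when [theta] vanishes. *)
Definition dgL (s : seq E) : E :=
  match s with
  | [:: f] => l1 Q f
  | [:: f; g] => l2 Q f g
  | _ => 0
  end.

Lemma dgL_long s : (2 < size s)%N -> dgL s = 0.
Proof. by case: s => [|f [|g [|h s]]]. Qed.

Lemma dgL_0 s : dgL (0 :: s) = 0.
Proof. by case: s => [|f [|g s]] //=; rewrite ?linear0 ?linear0l. Qed.

Lemma dgL_multilinear : multilinear dgL.
Proof.
move=> s1 s2 c u v.
case: s1 s2 => [|f [|g s1]] [|f' [|g' s2]] /=; rewrite ?scaler0 ?addr0 //.
- exact: linearP.
- by rewrite linearPl.
- by rewrite linearPr.
- by case: s1 => [|? ?]; rewrite /= ?scaler0 ?addr0.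
- by case: s1 => [|? ?]; rewrite /= ?scaler0 ?addr0.
- by case: s1 => [|? ?]; rewrite /= ?scaler0 ?addr0.
Qed.

Lemma dgL_symmetric N (d : 'I_N -> int) (x : 'I_N -> E) (s : 'S_N) :
  (0 < N)%N -> (forall i, cochain_deg (d i) (x i)) ->
  dgL (perm_seq x 1%g) = koszul K d s *: dgL (perm_seq x s).
Proof.
case: N d x s => [|[|[|N]]] // d x s _ hx; last first.
- by rewrite !dgL_long ?size_perm_seq // scaler0.
- rewrite !perm_seq2 koszul2 !perm1 /=.
  case: (perm2P s) => ->; first by rewrite !perm1 scale1r.
  rewrite !swap2E /= mulnC; apply: l2_sym; exact: deg_homog.
- by rewrite !perm_seq1 koszul1 scale1r !(ord1 (_ ord0)).
Qed.

Lemma dgL_degree N (d : 'I_N -> int) (x : 'I_N -> E) :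
  (0 < N)%N -> (forall i, cochain_deg (d i) (x i)) ->
  cochain_deg (1 + \sum_i d i) (dgL (perm_seq x 1%g)).
Proof.
case: N d x => [|[|[|N]]] // d x _ hx; last first.
- by rewrite dgL_long ?size_perm_seq // => s; rewrite eqxx.
- rewrite perm_seq2 !perm1 !big_ord_recl big_ord0 addr0 /=.
  set i := ord0; set j := lift ord0 ord0.
  have [hi|hi] := Num.Theory.ltrP (d i) 0.
    by rewrite (deg_neg (hx i) hi) linear0l => s; rewrite eqxx.
  have [hj|hj] := Num.Theory.ltrP (d j) 0.
    by rewrite (deg_neg (hx j) hj) linear0r => s; rewrite eqxx.
  have -> : 1 + (d i + d j) = (1 + `|d i| + `|d j|)%N%:Z by lia.
  exact/homog_deg/l2_homog/deg_homog/hx/deg_homog/hx.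
- rewrite perm_seq1 perm1 big_ord_recl big_ord0 addr0 /=.
  have [hi|hi] := Num.Theory.ltrP (d ord0) 0.
    by rewrite (deg_neg (hx ord0) hi) linear0 => s; rewrite eqxx.
  have -> : 1 + d ord0 = (1 + `|d ord0|)%N%:Z by lia.
  exact/homog_deg/l1_homog/deg_homog/hx.
Qed.

(** An operation applied to an operation needs at most three arguments to be
    nonzero, so only [N = 1, 2, 3] are to be considered: these are the square of [l1],
    the Leibniz rule and the Jacobi identity of [l2]. *)
Lemma dgL_jacobi N (d : 'I_N -> int) (x : 'I_N -> E) :
  (0 < N)%N -> (forall i, cochain_deg (d i) (x i)) ->
  \sum_(1 <= i < N.+1) \sum_(s : 'S_N | shuffle i s)
    koszul K d s *: dgL (dgL (take i (perm_seq x s)) :: drop i (perm_seq x s)) = 0.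
Proof.
move=> N0 hx.
have long i s : (2 < i <= N)%N || (2 < N.+1 - i)%N ->
    dgL (dgL (take i (perm_seq x s)) :: drop i (perm_seq x s)) = 0.
  case/orP=> [/andP[h2 hN]|h].
    by rewrite (dgL_long (s := take _ _)) ?dgL_0 // size_takel ?size_perm_seq.
  by rewrite dgL_long //= size_drop size_perm_seq; lia.
case: N d x N0 hx long => [|[|[|[|N]]]] // d x _ hx long; last first.
- rewrite big_nat big1 // => i hi; apply: big1 => s _.
  by rewrite long ?scaler0 //; lia.
- rewrite 3?big_ltn // big_geq // addr0.
  rewrite big1 => [|s _]; last by rewrite long ?scaler0.
  rewrite [X in _ + (_ + X)]big1 => [|s _]; last by rewrite long ?scaler0.
  rewrite add0r addr0 sum_shuffle32 !koszul3 !perm_seq3 !perm1 !swap12E !cycle3E /=.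
  rewrite ?mul1r ?mulr1 scale1r -exprD.
  have h := l2_jacobi char0 (nu_nu0 char0 theta0) (deg_homog (hx ord0))
    (deg_homog (hx (lift ord0 ord0))) (deg_homog (hx (lift ord0 (lift ord0 ord0)))).
  rewrite -[RHS]h; congr (_ + _ *: _ + _ *: _); congr (_ ^+ _); lia.
- rewrite 2?big_ltn // big_geq // addr0 sum_shuffle21 sum_shuffle22.
  rewrite !koszul2 !perm_seq2 !perm1 !swap2E /= !scale1r.
  set p := `|d ord0|%N; set q := `|d (lift ord0 ord0)|%N.
  have hf : homog p (x ord0) by exact: deg_homog.
  have hg : homog q (x (lift ord0 ord0)) by exact: deg_homog.
  have := l12_leibniz char0 (mu_nu0 char0 theta0) hf hg.
  rewrite (l2_sym Q hf (l1_homog Q hg)) => h; rewrite -[RHS]h.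
  rewrite -!(signr_odd _ (_ * _)) -!(signr_odd _ p) !oddM !oddD.
  by case: (odd p); case: (odd q); rewrite /= ?expr0 ?expr1; module_with (E : lmodType K).
- rewrite big_nat1 big1 // => s _; rewrite perm_seq1 /=.
  rewrite (l1_square char0 (mu_mu0 char0 theta0) (deg_homog (hx _))) scaler0 //.
Qed.

Lemma dgL_linfty : linfty_algebra (@cochain_deg K A B) dgL.
Proof.
split; [exact: cochain_grading | exact: dgL_multilinear | exact: dgL_symmetric
  | exact: dgL_degree | exact: dgL_jacobi].
Qed.

Lemma maurer_cartan_dgL (a : E) : cochain_deg 0 a ->
  maurer_cartan (@cochain_deg K A B) dgL a <-> l1 Q a + 2%:R^-1 *: l2 Q a a = 0.
Proof.
move=> ha; set F := fun k => (k`!%:R : K)^-1 *: dgL (nseq k a).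
have F3 k : (2 < k)%N -> F k = 0.
  by move=> hk; rewrite /F dgL_long ?size_nseq // scaler0.
have sumF n m : (n <= m)%N -> (forall k, (n < k)%N -> F k = 0) ->
    \sum_(1 <= k < m.+1) F k = \sum_(1 <= k < n.+1) F k.
  move=> hnm hF; rewrite (@big_cat_nat _ _ _ n.+1) //=.
  rewrite [X in _ + X]big_nat [X in _ + X]big1 ?addr0 // => k /andP[h _]; exact: hF.
have F2 : \sum_(1 <= k < 3) F k = l1 Q a + 2%:R^-1 *: l2 Q a a.
  by rewrite 2?big_ltn // big_geq // addr0 /F /= ?invr1 scale1r.
rewrite -F2; split=> [[_ [n hn hsum]]|hsum].
  have Fn k : (n < k)%N -> F k = 0 by move=> /hn h; rewrite /F h scaler0.
  rewrite -(sumF 2%N (maxn n 2)) ?leq_maxr // (sumF n) ?leq_maxl //.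
by split=> //; exists 2%N => // k hk; rewrite dgL_long // size_nseq.
Qed.

(** Evaluated at [a, b], the Maurer-Cartan equation is the difference of the two
    sides of the equation of a strong deformation map. *)
Lemma strong_deformation_dgL (D : {linear A -> B}) :
  strong_deformation Q D <->
  maurer_cartan (@cochain_deg K A B) dgL (lin_cochain D).
Proof.
have hD : homog 0 (lin_cochain D) := lin_homog D.
rewrite maurer_cartan_dgL; last exact: homog_deg.
have h1 := l1_homog Q hD; have h2 := l2_homog Q hD hD.
set c := l1 Q _ + _.
have hc s : size s != 2%N -> c s = 0.
  by move=> hs; rewrite -[c s]/(l1 Q _ s + _ *: l2 Q _ _ s) h1 // h2 // scaler0 addr0.
have ec a b : c [:: a; b] = bmul Q (D a) (D b) + ltri Q a (D b) + rtri Q (D a) b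
    - D (amul Q a b + lharp Q a (D b) + rharp Q (D a) b).
  set eD := ext (lin_cochain D); pose s : seq (A * B)%type := [:: (a, 0); (b, 0)].
  rewrite -[LHS]/((gbracket (mu_cochain Q) eD s).2
    + 2%:R^-1 *: (gbracket (gbracket (nu_cochain Q) eD) eD s).2).
  have hN := gbracket_homog (bilin_homog (nu_fun Q)) (ext_homog hD).
  rewrite /eD /s (gbracket_lin D _ _ hN) !gbracket_lin; try exact: bilin_homog.
  rewrite /= /mu_fun /nu_fun /= !mul0 !linear0 !add0r !addr0.
  have DD u v : D (u + v) = D u + D v by exact: linearD.
  have half (v : B) : 2%:R^-1 *: (v + v) = v.
    by rewrite -mulr2n -scaler_nat scalerA mulVf ?scale1r // (natS_neq0 char0 1).
  pose r := bmul Q (D a) (D b) - D (rharp Q (D a) b) - D (lharp Q a (D b)).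
  rewrite !DD [X in _ *: X](_ : _ = r + r) ?half /r; module_with B.
split=> [h|c0 a b].
  apply: cochainP => -[|a [|b [|b' s]]]; try by rewrite hc.
  by rewrite ec h theta0 addr0 subrr.
have := ec a b; rewrite c0 theta0 addr0 => /esym/eqP; rewrite subr_eq0 eq_sym => /eqP.
by [].
Qed.

End MatchedLinfty.

Lemma lD_twist (K : fieldType) (A B : lmodType K) (Q : quasi_twilled A B)
  (D : {linear A -> B}) : lD Q D = dgL (twist Q D).
Proof.
by apply/funext => -[|f [|g [|h s]]] //=; rewrite ?l1_twist ?l2_twist.
Qed.

Theorem theorem5p3 (K : fieldType) (char0 : [pchar K] =i pred0)
    (A B : lmodType K) (Q : quasi_twilled A B)
    (D : {linear A -> B}) (hD : strong_deformation Q D) :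
  [/\ (* the brackets defining l_1 and l_2 lie in the image of [ext] *)
      forall f : cochain A B, ext (l1 Q f) = gbracket (mu_cochain Q) (ext f),
      forall f g : cochain A B,
        ext (l2 Q f g) = gbracket (gbracket (nu_cochain Q) (ext f)) (ext g),
      linfty_algebra (@cochain_deg K A B) (lD Q D) &
      forall D' : {linear A -> B},
        strong_deformation Q (D \+ D') <->
        maurer_cartan (@cochain_deg K A B) (lD Q D) (lin_cochain D')].
Proof.
have theta0 := theta_twist hD; rewrite lD_twist; split.
- exact: ext_l1.
- exact: ext_l2.
- exact: dgL_linfty.
- by move=> D'; rewrite strong_deformation_twist; apply: strong_deformation_dgL.
Qed.
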